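(* Let $k$ be a field and $\rho_A\colon BG\to\mathrm{dgCat}_k$ a functor describing a strict action of a group $G$ on a dg-category $A$. Suppose that $A$ is cofibrant in $\mathrm{dgCat}_k$ (with respect to the quasi-equivalence model structure) and that the action of $G$ is free on the set of objects of $A$. Then the dg-category $(A\ast G)^{\mathrm{red}}$ is the tip of a (strictly commuting) homotopy colimit cocone under the functor $\rho_A$ with respect to the quasi-equivalence model structure on $\mathrm{dgCat}_k$.
   Context: $BG$ is the category with one object $\ast$ with endomorphisms $G$, and $\rho_A(\ast)=A$. The quasi-equivalence model structure on $\mathrm{dgCat}_k$ is the standard one with weak equivalences the quasi-equivalences. Skew group dg-category $A\ast G$: objects $\tilde X$ for $X\in A$; $\mathrm{Map}_{A\ast G}(\tilde X,\tilde Y)=\coprod_{g\in G}\mathrm{Map}_A(g.X,Y)$, with $(g,a)\colon\tilde X\to\tilde Y$ the morphism corresponding to $a\colon g.X\to Y$; composition $(g_2,b)\circ(g_1,a)=(g_2g_1,b\circ(g_2.a))$. Choosing for every $G$-orbit of objects of $A$ an arbitrary representative, $(A\ast G)^{\mathrm{red}}$ is the full dg-subcategory of $A\ast G$ on the objects $\tilde X$ with $X$ a chosen representative. When the action is free on objects, the cocone is given by the $G$-invariant dg-functor $A\to(A\ast G)^{\mathrm{red}}$ which is the composite of $A\to A\ast G$, $X\mapsto\tilde X$, $a\mapsto(e,a)$, with the equivalence $A\ast G\simeq(A\ast G)^{\mathrm{red}}$ determined by the isomorphisms $(g,\mathrm{id}_{g.X})\colon\tilde X\to\widetilde{g.X}$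 for $X$ a representative. ''Strictly commuting'' means that it is a cocone in the $1$-category $\mathrm{dgCat}_k$. *)

(* Defs.v *)
From HB Require Import structures.
From mathcomp Require Import all_boot all_order all_algebra.
From mathcomp Require Import boolp classical_sets functions cardinality fsbigop.

Set Implicit Arguments.
Unset Strict Implicit.
Unset Printing Implicit Defensive.

Import GRing.Theory.
Local Open Scope ring_scope.

Record category := Category {
  obj :> Type;
  hom : obj -> obj -> Type;
  idc : forall x, hom x x;
  comp : forall x y z, hom y z -> hom x y -> hom x z;
  compA : forall x y z t (h : hom z t) (g : hom y z) (f : hom x y),
    comp h (comp g f) = comp (comp h g) f;
  comp1c : forall x y (f : hom x y), comp (idc y) f = f;
  compc1 : forall x y (f : hom x y), comp f (idc x) = f }.

Arguments hom {c} : rename.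
Arguments idc {c} : rename.
Arguments comp {c x y z} : rename.
Notation "g \oc f" := (comp g f) (at level 50, left associativity).

Record functor (I C : category) := Functor {
  fobj :> I -> C;
  fmap : forall i j : I, hom i j -> hom (fobj i) (fobj j);
  fmap1 : forall i, fmap (idc i) = idc (fobj i);
  fmapM : forall i j l (v : hom j l) (u : hom i j),
    fmap (v \oc u) = fmap v \oc fmap u }.

Record nattrans (I C : category) (D E : functor I C) := Nattrans {
  ncomp :> forall i, hom (D i) (E i);
  ncompE : forall i j (u : hom i j),
    ncomp j \oc fmap D u = fmap E u \oc ncomp i }.

Section FunctorCategory.
Variables I C : category.

Lemma nattrans_eq (D E : functor I C) (a b : nattrans D E) :
  (forall i, a i = b i) -> a = b.
Proof.
case: a b => [a pa] [b pb] /= ab.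
have {}ab : a = b by apply: functional_extensionality_dep.
by subst b; rewrite (Prop_irrelevance pa pb).
Qed.

Lemma nattrans_id_subproof (D : functor I C) i j (u : hom i j) :
  idc (D j) \oc fmap D u = fmap D u \oc idc (D i).
Proof. by rewrite comp1c compc1. Qed.

Definition nattrans_id (D : functor I C) : nattrans D D :=
  Nattrans (@nattrans_id_subproof D).

Lemma nattrans_comp_subproof (D E F : functor I C)
    (b : nattrans E F) (a : nattrans D E) i j (u : hom i j) :
  (b j \oc a j) \oc fmap D u = fmap F u \oc (b i \oc a i).
Proof. by rewrite -compA ncompE compA ncompE compA. Qed.

Definition nattrans_comp (D E F : functor I C)
    (b : nattrans E F) (a : nattrans D E) : nattrans D F :=
  Nattrans (@nattrans_comp_subproof D E F b a).

Definition functor_cat : category.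
Proof.
refine (@Category (functor I C) (@nattrans I C) nattrans_id nattrans_comp _ _ _).
- by move=> *; apply: nattrans_eq => i; apply: compA.
- by move=> *; apply: nattrans_eq => i; apply: comp1c.
- by move=> *; apply: nattrans_eq => i; apply: compc1.
Defined.

Variable D : functor I C.

Definition is_cocone (t : C) (c : forall i, hom (D i) t) : Prop :=
  forall i j (u : hom i j), c j \oc fmap D u = c i.

Definition is_colimit (t : C) (c : forall i, hom (D i) t) : Prop :=
  is_cocone c /\
  forall (s : C) (b : forall i, hom (D i) s), is_cocone b ->
    exists! m : hom t s, forall i, m \oc c i = b i.

End FunctorCategory.

Definition is_initial (C : category) (o : C) : Prop :=
  forall x : C, exists! f : hom o x, True.

(* The two classes of maps that determine a model structure: its cofibrations
   are the maps with the left lifting property against trivial fibrations. *)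
Record model_data (C : category) := ModelData {
  weq : forall x y : C, hom x y -> Prop;
  fib : forall x y : C, hom x y -> Prop }.

Definition has_lifts (C : category) (a b x y : C) (i : hom a b) (p : hom x y) :=
  forall (u : hom a x) (v : hom b y), p \oc u = v \oc i ->
    exists l : hom b x, l \oc i = u /\ p \oc l = v.

Section Model.
Variables (C : category) (M : model_data C).

Definition cofibration (a b : C) (i : hom a b) : Prop :=
  forall (x y : C) (p : hom x y), weq M p -> fib M p -> has_lifts i p.

Definition cofibrant (x : C) : Prop :=
  exists (o : C) (i : hom o x), is_initial o /\ cofibration i.

End Model.

Section HomotopyColimit.
Variables (C : category) (M : model_data C).

Definition projective_model (I : category) : model_data (functor_cat I C) :=
  @ModelData (functor_cat I C)
    (fun D E (a : nattrans D E) => forall i, weq M (a i))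
    (fun D E (a : nattrans D E) => forall i, fib M (a i)).

(* The cocone [c] is strict, and it exhibits [t] as the value of the left
   derived functor of colim at [D]: whenever [Q -> D] is a projectively
   cofibrant replacement, the comparison map [colim Q -> t] is a weak
   equivalence.  (Replacements and colimits exist in a cofibrantly generated
   model category, and the condition depends on the choice of neither.) *)
Definition is_hocolim_cocone (I : category) (D : functor I C)
    (t : C) (c : forall i, hom (D i) t) : Prop :=
  is_cocone c /\
  forall (Q : functor_cat I C) (q : nattrans Q D),
    cofibrant (projective_model I) Q ->
    (forall i, weq M (q i)) ->
  forall (s : C) (b : forall i, hom (fobj Q i) s), is_colimit b ->
  forall m : hom s t, (forall i, m \oc b i = c i \oc q i) -> weq M m.

End HomotopyColimit.

(* Cohomological grading.  Composition and differential take the target degree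
   [p] together with a proof of the degree equation; such proofs are unique
   ([int] has decidable equality), so this adds no structure and avoids casts
   between, e.g., degrees [(l + m) + n] and [l + (m + n)]. *)
Record is_dgcat (k : fieldType) (ob : Type) (mor : ob -> ob -> int -> lmodType k)
  (dif : forall x y (n p : int), n + 1 = p -> mor x y n -> mor x y p)
  (idm : forall x, mor x x 0)
  (cmp : forall x y z (m n p : int), m + n = p ->
     mor y z m -> mor x y n -> mor x z p) : Prop := IsDgcat {
  dif_lin : forall x y n p (e : n + 1 = p), linear (@dif x y n p e);
  cmp_linl : forall x y z m n p (e : m + n = p) (f : mor x y n),
    linear (fun g : mor y z m => cmp x y z m n p e g f);
  cmp_linr : forall x y z m n p (e : m + n = p) (g : mor y z m),
    linear (fun f : mor x y n => cmp x y z m n p e g f);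
  difK : forall x y n p q (e : n + 1 = p) (e' : p + 1 = q) (f : mor x y n),
    dif x y p q e' (dif x y n p e f) = 0;
  dif_cmp : forall x y z m n p q m' n' (e : m + n = p) (ep : p + 1 = q)
      (em : m + 1 = m') (en : n + 1 = n') (e1 : m' + n = q) (e2 : m + n' = q)
      (g : mor y z m) (f : mor x y n),
    dif x z p q ep (cmp x y z m n p e g f) =
      cmp x y z m' n q e1 (dif y z m m' em g) f
      + (-1) ^+ `|m|%N *: cmp x y z m n' q e2 g (dif x y n n' en f);
  cmpA : forall x y z t l m n a b q
      (e1 : l + m = a) (e2 : a + n = q) (e3 : m + n = b) (e4 : l + b = q)
      (h : mor z t l) (g : mor y z m) (f : mor x y n),
    cmp x z t l b q e4 h (cmp x y z m n b e3 g f) =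
      cmp x y t a n q e2 (cmp y z t l m a e1 h g) f;
  cmp1m : forall x y n (e : 0 + n = n) (f : mor x y n),
    cmp x y y 0 n n e (idm y) f = f;
  cmpm1 : forall x y n (e : n + 0 = n) (f : mor x y n),
    cmp x x y n 0 n e f (idm x) = f }.

Record dgcat (k : fieldType) := Dgcat {
  ob :> Type;
  mor : ob -> ob -> int -> lmodType k;
  dif : forall x y (n p : int), n + 1 = p -> mor x y n -> mor x y p;
  idm : forall x, mor x x 0;
  cmp : forall x y z (m n p : int), m + n = p ->
    mor y z m -> mor x y n -> mor x z p;
  dgcatP : is_dgcat dif idm cmp }.

Arguments mor {k d} : rename.
Arguments dif {k d x y n p} : rename.
Arguments idm {k d} : rename.
Arguments cmp {k d x y z m n p} : rename.

Record is_dgfunctor (k : fieldType) (A B : dgcat k) (F : A -> B)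
    (Fm : forall x y n, mor x y n -> mor (F x) (F y) n) : Prop := IsDgfunctor {
  fmor_lin : forall x y n, linear (Fm x y n);
  fmor_dif : forall x y n p (e : n + 1 = p) (f : mor x y n),
    Fm x y p (dif e f) = dif e (Fm x y n f);
  fmor_id : forall x, Fm x x 0 (idm x) = idm (F x);
  fmor_cmp : forall x y z m n p (e : m + n = p)
      (g : mor y z m) (f : mor x y n),
    Fm x z p (cmp e g f) = cmp e (Fm y z m g) (Fm x y n f) }.

Record dgfunctor (k : fieldType) (A B : dgcat k) := Dgfunctor {
  fob :> A -> B;
  fmor : forall x y n, mor x y n -> mor (fob x) (fob y) n;
  dgfunctorP : is_dgfunctor fmor }.

Arguments fmor {k A B} d {x y n} : rename.

Section DgCat.
Variable k : fieldType.
Implicit Types A B C D : dgcat k.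

Lemma dgfunctor_eq A B (F : A -> B) (Fm Fm' : forall x y n, mor x y n -> mor (F x) (F y) n)
    (p : is_dgfunctor Fm) (q : is_dgfunctor Fm') :
  Fm = Fm' -> Dgfunctor p = Dgfunctor q.
Proof. by move=> e; subst Fm'; rewrite (Prop_irrelevance p q). Qed.

Lemma dgid_subproof A : is_dgfunctor (fun (x y : A) n (f : mor x y n) => f).
Proof. by []. Qed.

Definition dgid A : dgfunctor A A := Dgfunctor (dgid_subproof A).

Lemma dgcomp_subproof A B C (G : dgfunctor B C) (F : dgfunctor A B) :
  is_dgfunctor (fun (x y : A) n (f : mor x y n) => fmor G (fmor F f)).
Proof.
split.
- by move=> x y n a u v; rewrite (fmor_lin (dgfunctorP F)) (fmor_lin (dgfunctorP G)).
- by move=> *; rewrite (fmor_dif (dgfunctorP F)) (fmor_dif (dgfunctorP G)).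
- by move=> *; rewrite (fmor_id (dgfunctorP F)) (fmor_id (dgfunctorP G)).
- by move=> *; rewrite (fmor_cmp (dgfunctorP F)) (fmor_cmp (dgfunctorP G)).
Qed.

Definition dgcomp A B C (G : dgfunctor B C) (F : dgfunctor A B) : dgfunctor A C :=
  Dgfunctor (dgcomp_subproof G F).

Definition dgCat : category.
Proof.
refine (@Category (dgcat k) (@dgfunctor k) dgid dgcomp _ _ _).
- by move=> A B C D h g f; apply: dgfunctor_eq.
- by move=> A B [F Fm p]; apply: dgfunctor_eq.
- by move=> A B [F Fm p]; apply: dgfunctor_eq.
Defined.

Section Homotopy.
Variable A : dgcat k.

Definition is_cycle (x y : A) n (f : mor x y n) : Prop :=
  dif (erefl (n + 1)) f = 0.

Definition homologous (x y : A) n (f g : mor x y n) : Prop :=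
  exists h : mor x y (n - 1), dif (subrK 1 n) h = f - g.

(* The closed degree 0 morphism [u] represents an isomorphism of H^0(A). *)
Definition H0_iso (x y : A) (u : mor x y 0) : Prop :=
  is_cycle u /\ exists v : mor y x 0,
    [/\ is_cycle v, homologous (cmp (addr0 0) v u) (idm x)
      & homologous (cmp (addr0 0) u v) (idm y)].

Definition cast_src (x x' y : A) n (e : x = x') (f : mor x y n) : mor x' y n :=
  ecast z (mor z y n) e f.

Definition cast_tgt (x y y' : A) n (e : y = y') (f : mor x y n) : mor x y' n :=
  ecast z (mor x z n) e f.

End Homotopy.

(* H^n(F) : H^n(A(x, y)) -> H^n(B(Fx, Fy)) is injective and surjective for all
   n, x, y, and H^0(F) is essentially surjective. *)
Definition quasi_equivalence A B (F : dgfunctor A B) : Prop :=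
  [/\ forall (x y : A) n (f g : mor x y n), is_cycle f -> is_cycle g ->
        homologous (fmor F f) (fmor F g) -> homologous f g,
      forall (x y : A) n (g : mor (F x) (F y) n), is_cycle g ->
        exists2 f : mor x y n, is_cycle f & homologous (fmor F f) g
    & forall b : B, exists (a : A) (u : mor (F a) b 0), H0_iso u].

Definition dg_fibration A B (F : dgfunctor A B) : Prop :=
  (forall (x y : A) n (g : mor (F x) (F y) n),
     exists f : mor x y n, fmor F f = g) /\
  (forall (x : A) (b : B) (v : mor (F x) b 0), H0_iso v ->
     exists (y : A) (e : F y = b) (u : mor x y 0),
       H0_iso u /\ homologous (cast_tgt e (fmor F u)) v).

(* Tabuada's model structure. *)
Definition qe_model : model_data dgCat :=
  @ModelData dgCat quasi_equivalence dg_fibration.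

End DgCat.

Section Dsum.
Variables (k : fieldType) (G : choiceType) (M : G -> lmodType k).

Definition fin_supp (f : forall g, M g) : Prop :=
  finite_set [set g | f g != 0].

Record dsum := Dsum { dfun :> forall g, M g; dfunP : fin_supp dfun }.

HB.instance Definition _ := gen_eqMixin dsum.
HB.instance Definition _ := gen_choiceMixin dsum.

Lemma dsum_eq (f f' : dsum) : (forall g, f g = f' g) -> f = f'.
Proof.
case: f f' => [f pf] [f' pf'] /= ff'.
have {}ff' : f = f' by apply: functional_extensionality_dep.
by subst f'; rewrite (Prop_irrelevance pf pf').
Qed.

Lemma dsum0_subproof : fin_supp (fun=> 0).
Proof. by apply: (@sub_finite_set _ _ set0) => // g /=; rewrite eqxx. Qed.
Definition dsum0 : dsum := Dsum dsum0_subproof.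

Lemma dsumN_subproof (f : dsum) : fin_supp (fun g => - f g).
Proof. by apply: sub_finite_set (dfunP f) => g /=; rewrite oppr_eq0. Qed.
Definition dsumN (f : dsum) : dsum := Dsum (dsumN_subproof f).

Lemma dsumD_subproof (f f' : dsum) : fin_supp (fun g => f g + f' g).
Proof.
have := dfunP f'; have := dfunP f.
rewrite /fin_supp => Hf Hf'.
have : finite_set ([set g | f g != 0] `|` [set g | f' g != 0])%classic.
  by rewrite finite_setU.
apply: sub_finite_set => g /=.
case: (eqVneq (f g) 0) => [->|]; last by left.
by rewrite add0r => ?; right.
Qed.
Definition dsumD (f f' : dsum) : dsum := Dsum (dsumD_subproof f f').

Lemma dsumZ_subproof (a : k) (f : dsum) : fin_supp (fun g => a *: f g).
Proof.
apply: sub_finite_set (dfunP f) => g /=.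
by apply: contra_neq => ->; rewrite scaler0.
Qed.
Definition dsumZ (a : k) (f : dsum) : dsum := Dsum (dsumZ_subproof a f).

Lemma dsumDA : associative dsumD.
Proof. by move=> *; apply: dsum_eq => g; apply: addrA. Qed.
Lemma dsumDC : commutative dsumD.
Proof. by move=> *; apply: dsum_eq => g; apply: addrC. Qed.
Lemma dsum0D : left_id dsum0 dsumD.
Proof. by move=> *; apply: dsum_eq => g; apply: add0r. Qed.
Lemma dsumND : left_inverse dsum0 dsumN dsumD.
Proof. by move=> *; apply: dsum_eq => g; apply: addNr. Qed.

HB.instance Definition _ :=
  GRing.isZmodule.Build dsum dsumDA dsumDC dsum0D dsumND.

Lemma dsumZA a b f : dsumZ a (dsumZ b f) = dsumZ (a * b) f.
Proof. by apply: dsum_eq => g; apply: scalerA. Qed.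
Lemma dsum1Z : left_id 1 dsumZ.
Proof. by move=> f; apply: dsum_eq => g; apply: scale1r. Qed.
Lemma dsumZDr : right_distributive dsumZ +%R.
Proof. by move=> *; apply: dsum_eq => g; apply: scalerDr. Qed.
Lemma dsumZDl f : {morph dsumZ^~ f : a b / a + b}.
Proof. by move=> *; apply: dsum_eq => g; apply: scalerDl. Qed.

HB.instance Definition _ :=
  GRing.Zmodule_isLmodule.Build k dsum dsumZA dsum1Z dsumZDr dsumZDl.

Lemma inj_subproof (g : G) (a : M g) :
  fin_supp (fun h => if pselect (g = h) is left e then ecast z (M z) e a else 0).
Proof.
apply: (@sub_finite_set _ _ [set g]) => [h /=|]; last exact: finite_set1.
by case: pselect => [e _|_]; rewrite ?eqxx.
Qed.

(* The inclusion of the summand of index [g]. *)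
Definition inj (g : G) (a : M g) : dsum := Dsum (inj_subproof a).

(* The linear map out of the direct sum with components [phi]. *)
Definition dlift (N : lmodType k) (phi : forall g, M g -> N) (f : dsum) : N :=
  \sum_(g \in [set: G]) phi g (f g).

Lemma dsumDE (f f' : dsum) g : (f + f') g = f g + f' g. Proof. by []. Qed.
Lemma dsumZE a (f : dsum) g : (a *: f) g = a *: f g. Proof. by []. Qed.
Lemma dsum0E g : (0 : dsum) g = 0. Proof. by []. Qed.

Lemma injE (g : G) (a : M g) : inj a g = a.
Proof. by rewrite /=; case: pselect => // e; rewrite (Prop_irrelevance e erefl). Qed.

Lemma injE_neq (g h : G) (a : M g) : g <> h -> inj a h = 0.
Proof. by move=> gh /=; case: pselect. Qed.

Lemma inj_lin (g : G) : linear (@inj g).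
Proof.
move=> c a b; apply: dsum_eq => h; rewrite dsumDE dsumZE.
case: (pselect (g = h)) => [e|ne]; first by subst h; rewrite !injE.
by rewrite !injE_neq// scaler0 addr0.
Qed.

Lemma lin0 (U V : lmodType k) (f : U -> V) : linear f -> f 0 = 0.
Proof. by move=> fl; have := fl (-1) 0 0; rewrite scaleN1r oppr0 addr0 => ->; rewrite scaleN1r addNr. Qed.

Lemma linD (U V : lmodType k) (f : U -> V) u v : linear f -> f (u + v) = f u + f v.
Proof. by move=> fl; have := fl 1 u v; rewrite !scale1r. Qed.

Lemma linZ (U V : lmodType k) (f : U -> V) a u : linear f -> f (a *: u) = a *: f u.
Proof. by move=> fl; have := fl a u 0; rewrite !addr0 (lin0 fl) addr0. Qed.

Lemma dsum_supp (f f' : dsum) : exists r : seq G,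
  uniq r /\ forall g, g \notin r -> f g = 0 /\ f' g = 0.
Proof.
have /finite_seqP[r rE] := dfunP f; have /finite_seqP[r' rE'] := dfunP f'.
exists (undup (r ++ r')); split; first exact: undup_uniq.
move=> g; rewrite mem_undup mem_cat negb_or => /andP[gr gr']; split.
- apply/eqP; apply: contraNT gr => fg.
  by have : [set g | f g != 0]%classic g := fg; rewrite rE.
- apply/eqP; apply: contraNT gr' => fg.
  by have : [set g | f' g != 0]%classic g := fg; rewrite rE'.
Qed.

Section Dlift.
Variable N : lmodType k.
Implicit Types phi psi : forall g, M g -> N.

Lemma dliftE phi (f : dsum) (r : seq G) : (forall g, phi g 0 = 0) ->
  uniq r -> (forall g, g \notin r -> f g = 0) ->
  dlift phi f = \sum_(g <- r) phi g (f g).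
Proof.
move=> phi0 r_uniq rf; rewrite /dlift (@fsbigE _ _ _ _ _ r)//.
  by apply: eq_bigl => g; rewrite in_setT.
by move=> g _ /rf ->.
Qed.

Lemma dlift_inj phi (g : G) (a : M g) : (forall g, phi g 0 = 0) ->
  dlift phi (inj a) = phi g a.
Proof.
move=> phi0; rewrite (@dliftE _ _ [:: g])//; first by rewrite big_seq1 injE.
by move=> h; rewrite inE => /eqP /nesym/injE_neq.
Qed.

Lemma dlift_lin phi : (forall g, linear (phi g)) -> linear (dlift phi).
Proof.
move=> phi_lin c f f'; have phi0 g : phi g 0 = 0 by apply: lin0.
have [r [r_uniq rf]] := dsum_supp f f'.
rewrite !(@dliftE _ _ r)//; try by move=> g /rf[].
  rewrite scaler_sumr -big_split/=; apply: eq_bigr => g _.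
  by rewrite -phi_lin.
by move=> g /rf[fg f'g]; rewrite dsumDE dsumZE fg f'g scaler0 addr0.
Qed.

Lemma dlift_lin_phi c phi psi f :
  (forall g, phi g 0 = 0) -> (forall g, psi g 0 = 0) ->
  dlift (fun g a => c *: phi g a + psi g a) f = c *: dlift phi f + dlift psi f.
Proof.
move=> phi0 psi0.
have [r [r_uniq rf]] := dsum_supp f f.
rewrite !(@dliftE _ _ r)//; try by move=> g /rf[].
  by rewrite scaler_sumr -big_split.
by move=> g; rewrite phi0 psi0 scaler0 addr0.
Qed.

End Dlift.

Lemma dsum_ind (P : dsum -> Prop) :
  P 0 -> (forall u v, P u -> P v -> P (u + v)) ->
  (forall g (a : M g), P (inj a)) -> forall f, P f.
Proof.
move=> P0 PD Pi f.
have [r [r_uniq rf]] := dsum_supp f f.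
have -> : f = \sum_(g <- r) inj (f g).
  apply: dsum_eq => h.
  transitivity (\sum_(g <- r) (inj (f g) : dsum) h); last first.
    by elim: (r) => [|g r' IH]; rewrite ?big_nil ?big_cons// dsumDE -IH.
  have [hr|hr] := boolP (h \in r).
    rewrite (bigD1_seq h)// injE big1 => [|g /eqP gh].
      exact/esym/addr0.
    by rewrite injE_neq.
  rewrite big_seq big1; first by case: (rf _ hr).
  by move=> g gr; rewrite injE_neq// => gh; rewrite -gh gr in hr.
by elim: (r) => [|g r' IH]; rewrite ?big_nil ?big_cons//; apply: PD.
Qed.

Lemma inj_eq (g h : G) (a : M g) (b : M h) (e : g = h) :
  ecast z (M z) e a = b -> inj a = inj b.
Proof. by subst h => /= ->. Qed.

End Dsum.

Definition BG (G : groupType) : category :=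
  @Category unit (fun _ _ => G) (fun _ => 1%g) (fun _ _ _ g h => (g * h)%g)
    (fun _ _ _ _ g h l => mulgA g h l) (fun _ _ g => mul1g g) (fun _ _ g => mulg1 g).

Section Casts.
Variables (k : fieldType) (A : dgcat k).

Lemma cast_src_lin (x x' y : A) n (e : x = x') :
  linear (cast_src e : mor x y n -> mor x' y n).
Proof. by subst x'. Qed.

Lemma cast_src_id (x y : A) n (e : x = x) (f : mor x y n) : cast_src e f = f.
Proof. by rewrite (Prop_irrelevance e erefl). Qed.

Lemma cast_src_trans (x x' x'' y : A) n (e : x = x') (e' : x' = x'') (f : mor x y n) :
  cast_src e' (cast_src e f) = cast_src (etrans e e') f.
Proof. by subst x'' x'. Qed.

Lemma cast_src_irr (x x' y : A) n (e e' : x = x') (f : mor x y n) :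
  cast_src e f = cast_src e' f.
Proof. by rewrite (Prop_irrelevance e e'). Qed.

Lemma dif_cast_src (x x' y : A) n p (en : n + 1 = p) (e : x = x') (f : mor x y n) :
  dif en (cast_src e f) = cast_src e (dif en f).
Proof. by subst x'. Qed.

Lemma cmp_cast_src (x x' y z : A) m n p (emn : m + n = p) (e : x = x')
    (g : mor y z m) (f : mor x y n) :
  cmp emn g (cast_src e f) = cast_src e (cmp emn g f).
Proof. by subst x'. Qed.

Lemma cmp_cast_mid (x y y' z : A) m n p (emn : m + n = p) (e : y = y')
    (g : mor y z m) (f : mor x y' n) :
  cmp emn (cast_src e g) f = cmp emn g (cast_tgt (esym e) f).
Proof. by subst y'. Qed.

Lemma cast_src_tgt (x x' y y' : A) n (e : x = x') (e' : y = y') (f : mor x y n) :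
  cast_src e (cast_tgt e' f) = cast_tgt e' (cast_src e f).
Proof. by subst x' y'. Qed.

Lemma cast_tgt_id (x y : A) n (e : y = y) (f : mor x y n) : cast_tgt e f = f.
Proof. by rewrite (Prop_irrelevance e erefl). Qed.

Lemma cast_tgt_trans (x y y' y'' : A) n (e : y = y') (e' : y' = y'') (f : mor x y n) :
  cast_tgt e' (cast_tgt e f) = cast_tgt (etrans e e') f.
Proof. by subst y'' y'. Qed.

Lemma cast_idm (x x' : A) (e : x = x') :
  cast_src e (idm x) = cast_tgt (esym e) (idm x').
Proof. by subst x'. Qed.

Lemma cmp_lin0l (x y z : A) m n p (e : m + n = p) (f : mor x y n) :
  cmp e (0 : mor y z m) f = 0.
Proof. exact: (lin0 (cmp_linl (dgcatP A) e f)). Qed.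

Lemma cmp_lin0r (x y z : A) m n p (e : m + n = p) (g : mor y z m) :
  cmp e g (0 : mor x y n) = 0.
Proof. exact: (lin0 (cmp_linr (dgcatP A) e g)). Qed.

Lemma dif_idm (x : A) (e : 0 + 1 = 1 :> int) : dif e (idm x) = 0.
Proof.
have e0 : 0 + 0 = 0 :> int by [].
have e1 : 1 + 0 = 1 :> int by [].
have := dif_cmp (dgcatP A) e0 e e e e1 e (idm x) (idm x).
rewrite (cmp1m (dgcatP A)) /= expr0 scale1r (cmpm1 (dgcatP A)) (cmp1m (dgcatP A)).
by rewrite -[LHS]addr0 => /addrI.
Qed.

End Casts.

Section FunctorCasts.
Variables (k : fieldType) (A B : dgcat k).

Lemma fmor_cast_src (F : dgfunctor A B) (x x' y : A) n (e : x = x') (f : mor x y n) :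
  fmor F (cast_src e f) = cast_src (f_equal (fob F) e) (fmor F f).
Proof. by subst x'. Qed.

Lemma dgfunctor_fmor (F F' : dgfunctor A B) : F = F' ->
  forall (x y : A) (ex : F x = F' x) (ey : F y = F' y) n (f : mor x y n),
  fmor F' f = cast_tgt ey (cast_src ex (fmor F f)).
Proof. by move=> e; subst F' => *; rewrite cast_src_id cast_tgt_id. Qed.

End FunctorCasts.

Section Skew.
Variables (k : fieldType) (G : groupType) (rho : functor (BG G) (dgCat k)).

Definition base : dgcat k := fobj rho tt.
Definition act (g : G) : dgfunctor base base := @fmap _ _ rho tt tt g.

Implicit Types X Y Z : base.

Lemma act1F : act 1%g = dgid base.
Proof. exact: (fmap1 rho tt). Qed.

Lemma actMF g h : act (g * h)%g = dgcomp (act g) (act h).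
Proof. exact: (@fmapM _ _ rho tt tt tt g h). Qed.

Lemma act1 X : X = act 1%g X.
Proof. by rewrite act1F. Qed.

Lemma actM g h X : act g (act h X) = act (g * h)%g X.
Proof. by rewrite actMF. Qed.

Definition skew_mor X Y (n : int) : lmodType k :=
  dsum (fun g : G => mor (act g X) Y n).

(* The morphism [(g, a) : X~ -> Y~] for [a : g.X -> Y]. *)
Definition hmor X Y n (g : G) (a : mor (act g X) Y n) : skew_mor X Y n :=
  @inj k G (fun g => mor (act g X) Y n) g a.

Definition skew_dif X Y (n p : int) (e : n + 1 = p) : skew_mor X Y n -> skew_mor X Y p :=
  dlift (fun g a => hmor (dif e a)).

Definition skew_idm X : skew_mor X X 0 := hmor (cast_src (act1 X) (idm X)).

Definition hcmp X Y Z (m n p : int) (e : m + n = p) (g2 g1 : G)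
    (b : mor (act g2 Y) Z m) (a : mor (act g1 X) Y n) : skew_mor X Z p :=
  @hmor X Z p (g2 * g1)%g (cmp e b (cast_src (actM g2 g1 X) (fmor (act g2) a))).

(* The bilinear extension of (g2, b) o (g1, a) = (g2 g1, b o g2.a). *)
Definition skew_cmp X Y Z (m n p : int) (e : m + n = p)
    (f2 : skew_mor Y Z m) (f1 : skew_mor X Y n) : skew_mor X Z p :=
  dlift (fun g2 b => dlift (fun g1 a => hcmp e b a) f1) f2.

Lemma hmor_lin X Y n g : linear (@hmor X Y n g).
Proof. exact: (@inj_lin k G (fun g => mor (act g X) Y n) g). Qed.

Lemma hmor0 X Y n g : @hmor X Y n g 0 = 0.
Proof. exact: lin0 (@hmor_lin X Y n g). Qed.

Lemma hmor_eq X Y n (g h : G) (e : g = h) (a : mor (act g X) Y n) (b : mor (act h X) Y n) :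
  cast_src (f_equal (fun g => act g X) e) a = b -> hmor a = hmor b.
Proof. by subst h => /= ->. Qed.

Lemma hcmp_linl X Y Z m n p (e : m + n = p) g2 g1 (a : mor (act g1 X) Y n) :
  linear (fun b : mor (act g2 Y) Z m => hcmp e b a).
Proof. by move=> c u v; rewrite /hcmp (cmp_linl (dgcatP base)) hmor_lin. Qed.

Lemma hcmp_linr X Y Z m n p (e : m + n = p) g2 g1 (b : mor (act g2 Y) Z m) :
  linear (fun a : mor (act g1 X) Y n => hcmp e b a).
Proof.
move=> c u v; rewrite /hcmp (fmor_lin (dgfunctorP (act g2))) cast_src_lin.
by rewrite (cmp_linr (dgcatP base)) hmor_lin.
Qed.

Lemma hcmp0l X Y Z m n p (e : m + n = p) g2 g1 (a : mor (act g1 X) Y n) :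
  hcmp e (0 : mor (act g2 Y) Z m) a = 0.
Proof. exact: lin0 (hcmp_linl e a). Qed.

Lemma hcmp0r X Y Z m n p (e : m + n = p) g2 g1 (b : mor (act g2 Y) Z m) :
  hcmp e b (0 : mor (act g1 X) Y n) = 0.
Proof. exact: lin0 (hcmp_linr e b). Qed.

Lemma dlift0 (N : lmodType k) (M : G -> lmodType k) (f : dsum M) (phi : forall g, M g -> N) :
  (forall g a, phi g a = 0) -> dlift phi f = 0.
Proof. by move=> phi0; rewrite /dlift fsbig1. Qed.

Lemma skew_dif_hmor X Y n p (e : n + 1 = p) g (a : mor (act g X) Y n) :
  skew_dif e (hmor a) = hmor (dif e a).
Proof.
rewrite /skew_dif dlift_inj// => h.
by rewrite (lin0 (dif_lin (dgcatP base) e)) hmor0.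
Qed.

Lemma skew_dif_lin X Y n p (e : n + 1 = p) : linear (@skew_dif X Y n p e).
Proof.
apply: dlift_lin => g c u v.
by rewrite (dif_lin (dgcatP base)) hmor_lin.
Qed.

Lemma skew_cmp_linr X Y Z m n p (e : m + n = p) (f2 : skew_mor Y Z m) :
  linear (fun f1 : skew_mor X Y n => skew_cmp e f2 f1).
Proof.
move=> c u v; rewrite /skew_cmp -dlift_lin_phi; last 2 first.
- by move=> g; apply: dlift0 => h a; apply: hcmp0l.
- by move=> g; apply: dlift0 => h a; apply: hcmp0l.
congr dlift; apply: functional_extensionality_dep => g2.
apply: functional_extensionality_dep => b.
by rewrite dlift_lin// => g1; apply: hcmp_linr.
Qed.

Lemma skew_cmp_linl X Y Z m n p (e : m + n = p) (f1 : skew_mor X Y n) :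
  linear (fun f2 : skew_mor Y Z m => skew_cmp e f2 f1).
Proof.
apply: dlift_lin => g2 c u v; rewrite -dlift_lin_phi.
- congr dlift; apply: functional_extensionality_dep => g1.
  by apply: functional_extensionality_dep => a; apply: hcmp_linl.
- by move=> g1; apply: hcmp0r.
- by move=> g1; apply: hcmp0r.
Qed.

Lemma skew_cmp_hmor X Y Z m n p (e : m + n = p) g2 g1
    (b : mor (act g2 Y) Z m) (a : mor (act g1 X) Y n) :
  skew_cmp e (hmor b) (hmor a) = hcmp e b a.
Proof.
rewrite /skew_cmp dlift_inj; first by rewrite dlift_inj// => g; apply: hcmp0r.
by move=> g; apply: dlift0 => *; apply: hcmp0l.
Qed.

Lemma skew_ind X Y n (P : skew_mor X Y n -> Prop) :
  P 0 -> (forall u v, P u -> P v -> P (u + v)) ->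
  (forall g (a : mor (act g X) Y n), P (hmor a)) -> forall f, P f.
Proof. exact: dsum_ind. Qed.

Lemma skew_cmp0l X Y Z m n p (e : m + n = p) (f1 : skew_mor X Y n) :
  skew_cmp e (0 : skew_mor Y Z m) f1 = 0.
Proof. exact: lin0 (skew_cmp_linl e f1). Qed.

Lemma skew_cmp0r X Y Z m n p (e : m + n = p) (f2 : skew_mor Y Z m) :
  skew_cmp e f2 (0 : skew_mor X Y n) = 0.
Proof. exact: lin0 (skew_cmp_linr e f2). Qed.

Lemma skew_cmpDl X Y Z m n p (e : m + n = p) (f1 : skew_mor X Y n) (u v : skew_mor Y Z m) :
  skew_cmp e (u + v) f1 = skew_cmp e u f1 + skew_cmp e v f1.
Proof. exact: (linD _ _ (skew_cmp_linl e f1)). Qed.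

Lemma skew_cmpDr X Y Z m n p (e : m + n = p) (f2 : skew_mor Y Z m) (u v : skew_mor X Y n) :
  skew_cmp e f2 (u + v) = skew_cmp e f2 u + skew_cmp e f2 v.
Proof. exact: (linD _ _ (skew_cmp_linr e f2)). Qed.

Lemma skew_dif0 X Y n p (e : n + 1 = p) : @skew_dif X Y n p e 0 = 0.
Proof. exact: lin0 (@skew_dif_lin X Y n p e). Qed.

Lemma skew_difD X Y n p (e : n + 1 = p) u v :
  @skew_dif X Y n p e (u + v) = skew_dif e u + skew_dif e v.
Proof. exact: (linD _ _ (@skew_dif_lin X Y n p e)). Qed.

Lemma actM_fmor g h X Y n (a : mor X Y n) :
  fmor (act (g * h)%g) a =
  cast_tgt (actM g h Y) (cast_src (actM g h X) (fmor (act g) (fmor (act h) a))).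
Proof.
exact: (dgfunctor_fmor (esym (actMF g h)) (actM g h X) (actM g h Y) a).
Qed.

Lemma act1_fmor X Y n (a : mor X Y n) :
  fmor (act 1%g) a = cast_tgt (act1 Y) (cast_src (act1 X) a).
Proof.
exact: (dgfunctor_fmor (esym act1F) (act1 X) (act1 Y) a).
Qed.

Lemma hcmpA (X Y Z T : base) l m n a b q
    (e1 : l + m = a) (e2 : a + n = q) (e3 : m + n = b) (e4 : l + b = q)
    (g3 g2 g1 : G) (w : mor (act g3 Z) T l) (v : mor (act g2 Y) Z m) (u : mor (act g1 X) Y n) :
  skew_cmp e4 (hmor w) (skew_cmp e3 (hmor v) (hmor u)) =
  skew_cmp e2 (skew_cmp e1 (hmor w) (hmor v)) (hmor u).
Proof.
rewrite !skew_cmp_hmor /hcmp.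
apply: (@hmor_eq _ _ _ _ _ (mulgA g3 g2 g1)).
rewrite (fmor_cmp (dgfunctorP (act g3))) fmor_cast_src.
rewrite !cmp_cast_src cmp_cast_mid.
rewrite (cmpA (dgcatP base) e1 e2 e3 e4).
rewrite actM_fmor cast_tgt_trans cast_tgt_id.
rewrite !cmp_cast_src !cast_src_trans.
exact: cast_src_irr.
Qed.

Lemma skew_dgcatP : is_dgcat skew_dif skew_idm skew_cmp.
Proof.
split.
- exact: skew_dif_lin.
- by move=> *; apply: skew_cmp_linl.
- by move=> *; apply: skew_cmp_linr.
- move=> X Y n p q e e'; apply: skew_ind.
  + by rewrite !skew_dif0.
  + by move=> u v hu hv; rewrite !skew_difD hu hv addr0.
  + by move=> g a; rewrite !skew_dif_hmor (difK (dgcatP base)) hmor0.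
- move=> X Y Z m n p q m' n' e ep em en e1 e2 g f; move: g f.
  apply: skew_ind.
  + by move=> f; rewrite !(skew_cmp0l, skew_dif0) scaler0 addr0.
  + move=> u v hu hv f; rewrite !(skew_cmpDl, skew_difD) hu hv scalerDr.
    by rewrite addrACA.
  move=> g b; apply: skew_ind.
  + by rewrite !(skew_cmp0r, skew_dif0) scaler0 addr0.
  + move=> u v hu hv; rewrite !(skew_cmpDr, skew_difD) hu hv scalerDr.
    by rewrite addrACA.
  move=> h a; rewrite skew_cmp_hmor /hcmp !skew_dif_hmor !skew_cmp_hmor /hcmp.
  rewrite (dif_cmp (dgcatP base) e ep em en e1 e2) dif_cast_src.
  rewrite -(fmor_dif (dgfunctorP (act g))).
  rewrite (linD _ _ (@hmor_lin _ _ _ _)).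
  by congr (_ + _); apply: (linZ _ _ (@hmor_lin _ _ _ _)).
- move=> X Y Z T l m n a b q e1 e2 e3 e4 h g f; move: h g f.
  apply: skew_ind.
  + by move=> g f; rewrite !skew_cmp0l.
  + by move=> u v hu hv g f; rewrite !skew_cmpDl hu hv.
  move=> g3 w; apply: skew_ind.
  + by move=> f; rewrite !(skew_cmp0l, skew_cmp0r).
  + by move=> u v hu hv f; rewrite !(skew_cmpDl, skew_cmpDr) hu hv.
  move=> g2 v; apply: skew_ind.
  + by rewrite !skew_cmp0r.
  + by move=> u u' hu hu'; rewrite !skew_cmpDr hu hu'.
  by move=> g1 u; apply: hcmpA.
- move=> X Y n e; apply: skew_ind.
  + by rewrite skew_cmp0r.
  + by move=> u v hu hv; rewrite skew_cmpDr hu hv.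
  move=> g a; rewrite skew_cmp_hmor /hcmp.
  apply: (@hmor_eq _ _ _ _ _ (mul1g g)).
  rewrite act1_fmor cmp_cast_mid !cast_src_tgt cast_tgt_trans cast_tgt_id.
  by rewrite (cmp1m (dgcatP base)) !cast_src_trans cast_src_id.
- move=> X Y n e; apply: skew_ind.
  + by rewrite skew_cmp0l.
  + by move=> u v hu hv; rewrite skew_cmpDl hu hv.
  move=> g a; rewrite skew_cmp_hmor /hcmp.
  apply: (@hmor_eq _ _ _ _ _ (mulg1 g)).
  rewrite fmor_cast_src (fmor_id (dgfunctorP (act g))) !cmp_cast_src.
  by rewrite (cmpm1 (dgcatP base)) !cast_src_trans cast_src_id.
Qed.

(* The objects are those of [A]: the object [X~] is represented by [X]. *)
Definition skew : dgcat k := Dgcat skew_dgcatP.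

End Skew.

Lemma conj_cmp (k : fieldType) (A : dgcat k) (x x' y y' z z' : A) m n p (e : m + n = p)
    (u : mor x' x 0) (v : mor y y' 0) (u' : mor y' y 0) (w : mor z z' 0)
    (g : mor y z m) (f : mor x y n) : cmp (addr0 0) u' v = idm y ->
  cmp (add0r p) w (cmp (addr0 p) (cmp e g f) u) =
  cmp e (cmp (add0r m) w (cmp (addr0 m) g u')) (cmp (add0r n) v (cmp (addr0 n) f u)).
Proof.
move=> uv; have S := cmpA (dgcatP A).
rewrite -(S _ _ _ _ _ _ _ _ _ _ (add0r m) e e (add0r p)).
congr (cmp _ _ _).
rewrite -(S _ _ _ _ _ _ _ _ _ _ (addr0 m) e (add0r n) e).
rewrite (S _ _ _ _ _ _ _ _ _ _ (addr0 0) (add0r n) (add0r n) (add0r n)).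
rewrite uv (cmp1m (dgcatP A)).
by rewrite -(S _ _ _ _ _ _ _ _ _ _ e (addr0 p) (addr0 n) e).
Qed.

Section FullSubcategory.
Variables (k : fieldType) (A : dgcat k) (P : A -> Prop).

Let sob := {x : A | P x}.
Let smor (x y : sob) n := mor (proj1_sig x) (proj1_sig y) n.

Lemma full_dgcatP : @is_dgcat k sob smor
  (fun x y n p e f => dif e f) (fun x => idm (proj1_sig x))
  (fun x y z m n p e g f => cmp e g f).
Proof.
split.
- by move=> *; apply: (dif_lin (dgcatP A)).
- by move=> *; apply: (cmp_linl (dgcatP A)).
- by move=> *; apply: (cmp_linr (dgcatP A)).
- by move=> *; apply: (difK (dgcatP A)).
- by move=> *; apply: (dif_cmp (dgcatP A)).
- by move=> *; apply: (cmpA (dgcatP A)).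
- by move=> *; apply: (cmp1m (dgcatP A)).
- by move=> *; apply: (cmpm1 (dgcatP A)).
Qed.

Definition full_dgsubcat : dgcat k := Dgcat full_dgcatP.

End FullSubcategory.

Section Reduced.
Variables (k : fieldType) (G : groupType) (rho : functor (BG G) (dgCat k)).

Definition free_on_objects : Prop :=
  forall (g : G) (X : base rho), act rho g X = X -> g = 1%g.

(* The chosen representatives are the objects [X] with [rep X = X]. *)
Record orbit_reps := OrbitReps {
  rep : base rho -> base rho;
  rep_orbit : forall X, exists g : G, act rho g (rep X) = X;
  rep_act : forall (g : G) X, rep (act rho g X) = rep X }.

Variable R : orbit_reps.

Lemma rep_rep X : rep R (rep R X) = rep R X.
Proof. by have [g {2}<-] := rep_orbit R X; rewrite rep_act. Qed.

Definition skew_red : dgcat k :=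
  @full_dgsubcat k (skew rho) (fun X => rep R X = X).

(* [X = to_rep X . rep X]; unique when the action is free on objects. *)
Definition to_rep X : G := projT1 (cid (rep_orbit R X)).

Lemma to_repE X : act rho (to_rep X) (rep R X) = X.
Proof. exact: projT2 (cid (rep_orbit R X)). Qed.

Lemma to_repVE X : rep R X = act rho (to_rep X)^-1%g X.
Proof.
have := f_equal (act rho (to_rep X)^-1%g) (to_repE X).
by rewrite actM mulVg -act1.
Qed.

(* The isomorphism [(g, id_{g.Y}) : Y~ -> X~] with [Y = rep X], [g = to_rep X],
   [X = g.Y], and its inverse [(g^-1, id_Y)]. *)
Definition rep_iso X : @mor k (skew rho) (rep R X) X 0 :=
  @hmor k G rho (rep R X) X 0 (to_rep X) (cast_src (esym (to_repE X)) (idm X)).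

Definition rep_iso_inv X : @mor k (skew rho) X (rep R X) 0 :=
  @hmor k G rho X (rep R X) 0 (to_rep X)^-1%g
    (cast_src (to_repVE X) (idm (rep R X))).

(* The dg-functor A -> A*G, X |-> X~, a |-> (e, a). *)
Definition skew_incl_mor (X Y : base rho) n (a : mor X Y n) : @mor k (skew rho) X Y n :=
  @hmor k G rho X Y n 1%g (cast_src (act1 X) a).

Lemma hmor_cast (X Y : base rho) n (g h : G) (a : mor (act rho g X) Y n)
    (b : mor (act rho h X) Y n) :
  g = h -> (forall e, cast_src e a = b) -> hmor a = hmor b.
Proof. by move=> e ab; apply: (hmor_eq (e := e)). Qed.

Lemma skew_incl_subproof :
  @is_dgfunctor k (base rho) (skew rho) id skew_incl_mor.
Proof.
split.
- by move=> X Y n c u v; rewrite /skew_incl_mor cast_src_lin hmor_lin.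
- move=> X Y n p e f; rewrite [RHS]skew_dif_hmor.
  by rewrite dif_cast_src.
- by [].
- move=> X Y Z m n p e g f; rewrite [RHS]skew_cmp_hmor /hcmp.
  apply: hmor_cast => [|e']; first by rewrite mulg1.
  rewrite fmor_cast_src act1_fmor cmp_cast_mid !cast_src_tgt cast_tgt_trans.
  rewrite cast_tgt_id !cmp_cast_src !cast_src_trans.
  exact: cast_src_irr.
Qed.

Definition skew_incl : dgfunctor (base rho) (skew rho) :=
  Dgfunctor skew_incl_subproof.

Lemma rep_isoK X :
  cmp (addr0 0) (rep_iso X) (rep_iso_inv X) = idm (X : skew rho).
Proof.
rewrite [LHS]skew_cmp_hmor /hcmp.
apply: hmor_cast => [|e']; first by rewrite mulgV.
rewrite fmor_cast_src (fmor_id (dgfunctorP (act rho _))) !cmp_cast_src.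
by rewrite (cmpm1 (dgcatP (base rho))) !cast_src_trans; apply: cast_src_irr.
Qed.

Lemma rep_isoVK X :
  cmp (addr0 0) (rep_iso_inv X) (rep_iso X) = idm (rep R X : skew rho).
Proof.
rewrite [LHS]skew_cmp_hmor /hcmp.
apply: hmor_cast => [|e']; first by rewrite mulVg.
rewrite fmor_cast_src (fmor_id (dgfunctorP (act rho _))) !cmp_cast_src.
by rewrite (cmpm1 (dgcatP (base rho))) !cast_src_trans; apply: cast_src_irr.
Qed.

Lemma dif_rep_iso X (e : 0 + 1 = 1 :> int) : dif e (rep_iso X) = 0.
Proof. by rewrite [LHS]skew_dif_hmor dif_cast_src dif_idm (lin0 (@cast_src_lin _ _ _ _ _ _ _)) hmor0. Qed.

Lemma dif_rep_iso_inv X (e : 0 + 1 = 1 :> int) : dif e (rep_iso_inv X) = 0.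
Proof. by rewrite [LHS]skew_dif_hmor dif_cast_src dif_idm (lin0 (@cast_src_lin _ _ _ _ _ _ _)) hmor0. Qed.

Definition conj_rep (X Y : skew rho) n (f : mor X Y n) :
    @mor k (skew rho) (rep R X) (rep R Y) n :=
  cmp (add0r n) (rep_iso_inv Y) (cmp (addr0 n) f (rep_iso X)).

Lemma conj_rep_lin X Y n : linear (@conj_rep X Y n).
Proof.
move=> c u v; rewrite /conj_rep (cmp_linl (dgcatP (skew rho))).
by rewrite (cmp_linr (dgcatP (skew rho))).
Qed.

Lemma conj_rep_dif (X Y : skew rho) n p (e : n + 1 = p) (f : mor X Y n) :
  conj_rep (dif e f) = dif e (conj_rep f).
Proof.
have e01 : 0 + 1 = 1 :> int by [].
have e1n : 1 + n = p by rewrite addrC.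
rewrite /conj_rep.
rewrite (dif_cmp (dgcatP (skew rho)) (add0r n) e e01 e e1n (add0r p)).
rewrite (dif_cmp (dgcatP (skew rho)) (addr0 n) e e e01 (addr0 p) e).
rewrite dif_rep_iso dif_rep_iso_inv cmp_lin0l cmp_lin0r.
by rewrite scaler0 add0r addr0 expr0 scale1r.
Qed.

Lemma conj_rep_cmp (X Y Z : skew rho) m n p (e : m + n = p)
    (g : mor Y Z m) (f : mor X Y n) :
  conj_rep (cmp e g f) = cmp e (conj_rep g) (conj_rep f).
Proof.
exact: conj_cmp (rep_isoK Y).
Qed.

Lemma conj_rep_id (X : skew rho) : conj_rep (idm X) = idm (rep R X : skew rho).
Proof.
rewrite /conj_rep (cmp1m (dgcatP (skew rho))) -[RHS]rep_isoVK.
by rewrite (Prop_irrelevance (add0r 0) (addr0 0)).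
Qed.

Definition skew_to_red_ob (X : skew rho) : skew_red := exist _ (rep R X) (rep_rep X).

Lemma skew_to_red_subproof :
  @is_dgfunctor k (skew rho) skew_red skew_to_red_ob conj_rep.
Proof.
split; first exact: conj_rep_lin.
- exact: conj_rep_dif.
- exact: conj_rep_id.
- exact: conj_rep_cmp.
Qed.

(* The equivalence A*G -> (A*G)^red, X~ |-> (rep X)~, transporting morphisms
   along the isomorphisms [rep_iso]. *)
Definition skew_to_red : dgfunctor (skew rho) skew_red :=
  Dgfunctor skew_to_red_subproof.

Definition to_red : dgfunctor (base rho) skew_red :=
  dgcomp skew_to_red skew_incl.

Definition red_cocone (i : BG G) : @hom (dgCat k) (fobj rho i) skew_red :=
  match i with tt => to_red end.

End Reduced.

(* Main.v *)
(* When G acts freely on objects, (A*G)^red is the strict quotient of A: a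
   G-invariant dg-functor out of A is the same as a dg-functor out of A*G that
   sends each (g, id) : X~ -> (g.X)~ to an identity, and A*G -> (A*G)^red is one.
   A projectively cofibrant Q is automatically free on objects, so colim Q is
   (Q*G)^red.  For a weak equivalence Q -> A, the map (Q*G)^red -> (A*G)^red is
   then equivalent to Q*G -> A*G, which on morphisms is the direct sum over G of
   the quasi-isomorphisms Q(g.X, Y) -> A(q(g.X), qY), hence a quasi-equivalence. *)

Require Import Defs.
From mathcomp Require Import all_boot all_order all_algebra.
From mathcomp Require Import boolp classical_sets functions cardinality.

Set Implicit Arguments.
Unset Strict Implicit.
Unset Printing Implicit Defensive.

Import Defs GRing.Theory.
Local Open Scope ring_scope.

(** * Dg-functors, surjective equivalences and quasi-equivalences *)

Section DgFunctors.
Variable k : fieldType.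
Implicit Types A B C : dgcat k.

Lemma dgfunctor_ext A B (F F' : dgfunctor A B) (e : forall x, F x = F' x) :
  (forall x y n (f : mor x y n),
     cast_tgt (e y) (cast_src (e x) (fmor F f)) = fmor F' f) -> F = F'.
Proof.
case: F F' e => [Fo Fm Fp] [Fo' Fm' Fp'] /= e.
have E : Fo = Fo' by apply: functional_extensionality_dep.
subst Fo' => H; apply: dgfunctor_eq.
do 4![apply: functional_extensionality_dep => ?].
by rewrite -H cast_src_id cast_tgt_id.
Qed.

Definition injective_on_homs A B (F : dgfunctor A B) : Prop :=
  forall (x y : A) n, injective (@fmor k A B F x y n).

Definition surjective_on_homs A B (F : dgfunctor A B) : Prop :=
  forall (x y : A) n (g : mor (F x) (F y) n), exists f, fmor F f = g.

(* An isomorphism of dg-categories up to repetition of objects. *)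
Definition surjective_equivalence A B (F : dgfunctor A B) : Prop :=
  [/\ injective_on_homs F, surjective_on_homs F & forall b, exists a, F a = b].

Lemma dgcompE A B C (H : dgfunctor B C) (F : dgfunctor A B) (x y : A) n (f : mor x y n) :
  fmor (dgcomp H F) f = fmor H (fmor F f).
Proof. by []. Qed.

Lemma fmorB A B (F : dgfunctor A B) (x y : A) n (f g : mor x y n) :
  fmor F (f - g) = fmor F f - fmor F g.
Proof.
have L := @fmor_lin _ _ _ _ _ (dgfunctorP F) x y n.
by rewrite (linD _ _ L) -scaleN1r (linZ _ _ L) scaleN1r.
Qed.

Lemma fmor0 A B (F : dgfunctor A B) (x y : A) n : fmor F (0 : mor x y n) = 0.
Proof. exact: lin0 (@fmor_lin _ _ _ _ _ (dgfunctorP F) x y n). Qed.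

Lemma fmor_cycle A B (F : dgfunctor A B) (x y : A) n (f : mor x y n) :
  is_cycle f -> is_cycle (fmor F f).
Proof. by rewrite /is_cycle -(fmor_dif (dgfunctorP F)) => ->; rewrite fmor0. Qed.

Lemma fmor_homologous A B (F : dgfunctor A B) (x y : A) n (f g : mor x y n) :
  homologous f g -> homologous (fmor F f) (fmor F g).
Proof.
move=> [h hE]; exists (fmor F h).
by rewrite -(fmor_dif (dgfunctorP F)) hE fmorB.
Qed.

Lemma fmor_H0_iso A B (F : dgfunctor A B) (x y : A) (u : mor x y 0) :
  H0_iso u -> H0_iso (fmor F u).
Proof.
move=> [cu [v [cv vu uv]]]; split; first exact: fmor_cycle.
exists (fmor F v); split; first exact: fmor_cycle.
- rewrite -(fmor_cmp (dgfunctorP F)) -(fmor_id (dgfunctorP F)).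
  exact: fmor_homologous.
- rewrite -(fmor_cmp (dgfunctorP F)) -(fmor_id (dgfunctorP F)).
  exact: fmor_homologous.
Qed.

Lemma is_cycle_inj A B (F : dgfunctor A B) (x y : A) n (f : mor x y n) :
  injective_on_homs F -> is_cycle (fmor F f) -> is_cycle f.
Proof.
move=> Finj; rewrite /is_cycle -(fmor_dif (dgfunctorP F)) -(fmor0 F).
exact: Finj.
Qed.

Lemma homologous_bij A B (F : dgfunctor A B) (x y : A) n (f g : mor x y n) :
  injective_on_homs F -> surjective_on_homs F ->
  homologous (fmor F f) (fmor F g) -> homologous f g.
Proof.
move=> Finj Fsurj [h]; have [h' <-] := Fsurj _ _ _ h => hE; exists h'.
by apply: Finj; rewrite (fmor_dif (dgfunctorP F)) hE fmorB.
Qed.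

Lemma quasi_equivalence_comp A B C (F : dgfunctor A B) (H : dgfunctor B C) :
  quasi_equivalence F -> surjective_equivalence H ->
  quasi_equivalence (dgcomp H F).
Proof.
move=> [F1 F2 F3] [H1 H2 H3]; split => /=.
- by move=> x y n f g cf cg /(homologous_bij H1 H2); apply: F1.
- move=> x y n g; have [g' <-] := H2 _ _ _ g => /(is_cycle_inj H1) cg'.
  have [f cf fg] := F2 _ _ _ _ cg'; exists f => //.
  exact: fmor_homologous.
- move=> c; have [b <-] := H3 c; have [a [u u_iso]] := F3 b.
  by exists a, (fmor H u); apply: fmor_H0_iso.
Qed.

(** Since [F] is surjective on objects and bijective on morphisms, every question about [H] on [B]
    is the same question about [dgcomp H F] on preimages in [A]. *)
Lemma quasi_equivalence_cancel A B C (F : dgfunctor A B) (H : dgfunctor B C) :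
  surjective_equivalence F -> quasi_equivalence (dgcomp H F) ->
  quasi_equivalence H.
Proof.
move=> [F1 F2 F3] [H1 H2 H3]; split => /=.
- move=> x y; have [x' <-] := F3 x; have [y' <-] := F3 y => n f g.
  have [f' <-] := F2 _ _ _ f; have [g' <-] := F2 _ _ _ g.
  move=> /(is_cycle_inj F1) cf /(is_cycle_inj F1) cg /(H1 _ _ _ _ _ cf cg).
  exact: fmor_homologous.
- move=> x y; have [x' <-] := F3 x; have [y' <-] := F3 y => n g cg.
  have [f cf fg] := H2 _ _ _ _ cg.
  by exists (fmor F f) => //; apply: fmor_cycle.
- by move=> c; have [a [u u_iso]] := H3 c; exists (F a), u.
Qed.

Lemma retract_injective_on_homs A B (F : dgfunctor A B) (H : dgfunctor B A) :
  dgcomp H F = dgid A -> injective_on_homs F.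
Proof.
move=> HF x y n f g /(f_equal (fun h => fmor H h)) fg.
have HFx z : z = dgcomp H F z by rewrite HF.
have E h := dgfunctor_fmor HF (esym (HFx x)) (esym (HFx y)) (h : mor x y n).
by have := E f; rewrite /= fg -[X in _ = X](E g).
Qed.

(** [F] is a split monomorphism, so bijectivity on morphisms passes from [dgcomp F P] to [P];
    applying [H] to [F (P a) = F b] gives [P a = b]. It will be used with [B] a colimit and [F] its
    map to the reduced skew category. *)
Lemma surjective_equivalence_section A B C
    (P : dgfunctor A B) (F : dgfunctor B C) (H : dgfunctor C B) :
  dgcomp H F = dgid B -> surjective_equivalence (dgcomp F P) ->
  surjective_equivalence P.
Proof.
move=> HF [R1 R2 R3]; have Finj := retract_injective_on_homs HF; split.
- by move=> x y n f g fg; apply: R1; rewrite /= fg.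
- move=> x y n h; have [f fE] := R2 _ _ _ (fmor F h).
  by exists f; apply: Finj.
- move=> b; have [a aE] := R3 (F b); exists a.
  have HFb z : H (F z) = z by rewrite -[RHS]/(dgid B z) -HF.
  by rewrite -[LHS]HFb -[RHS]HFb -aE.
Qed.

Lemma full_cast_src A (P : A -> Prop) (x x' y : full_dgsubcat P) n (e : x = x')
    (f : mor x y n) :
  cast_src e f = @cast_src k A _ _ _ n (f_equal (@proj1_sig _ _) e) f.
Proof. by subst x'. Qed.

Lemma full_cast_tgt A (P : A -> Prop) (x y y' : full_dgsubcat P) n (e : y = y')
    (f : mor x y n) :
  cast_tgt e f = @cast_tgt k A _ _ _ n (f_equal (@proj1_sig _ _) e) f.
Proof. by subst y'. Qed.

Lemma full_incl_subproof A (P : A -> Prop) :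
  @is_dgfunctor k (full_dgsubcat P) A (@proj1_sig _ _) (fun x y n f => f).
Proof. by []. Qed.

Definition full_incl A (P : A -> Prop) : dgfunctor (full_dgsubcat P) A :=
  Dgfunctor (full_incl_subproof P).

Lemma cast_tgt_irr A (x y y' : A) n (e e' : y = y') (f : mor x y n) :
  cast_tgt e f = cast_tgt e' f.
Proof. by rewrite (Prop_irrelevance e e'). Qed.

End DgFunctors.

(** * Dg-functors out of the skew group dg-category *)

Section SkewFunctors.
Variables (k : fieldType) (G : groupType) (rho : functor (BG G) (dgCat k)).

Section Lift.
Variables (B : dgcat k) (Fo : base rho -> B).
Variable phi : forall (X Y : base rho) n (g : G),
  mor (act rho g X) Y n -> mor (Fo X) (Fo Y) n.
Hypothesis phi_lin : forall X Y n g, linear (@phi X Y n g).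
Hypothesis phi_dif : forall X Y n p (e : n + 1 = p) g (a : mor (act rho g X) Y n),
  phi (dif e a) = dif e (phi a).
Hypothesis phi_id : forall X, phi (cast_src (act1 X) (idm X)) = idm (Fo X).
Hypothesis phi_cmp : forall X Y Z m n p (e : m + n = p) h g
    (b : mor (act rho h Y) Z m) (a : mor (act rho g X) Y n),
  phi (cmp e b (cast_src (actM h g X) (fmor (act rho h) a))) =
  cmp e (phi b) (phi a).

Definition skew_lift_mor (X Y : skew rho) n (f : mor X Y n) : mor (Fo X) (Fo Y) n :=
  dlift (@phi X Y n) f.

Lemma skew_lift_hmor (X Y : base rho) n g (a : mor (act rho g X) Y n) :
  @skew_lift_mor X Y n (hmor a) = phi a.
Proof. by apply: dlift_inj => h; apply: lin0. Qed.

Lemma skew_lift_lin X Y n : linear (@skew_lift_mor X Y n).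
Proof. exact: dlift_lin. Qed.

(** Both sides of each axiom are additive in every morphism, so [skew_ind] reduces to the morphisms
    (g, a), where the axioms are the hypotheses on [phi]. *)
Lemma skew_lift_subproof : @is_dgfunctor k (skew rho) B Fo skew_lift_mor.
Proof.
have L := skew_lift_lin.
split => //.
- move=> X Y n p e; apply: skew_ind.
  + by rewrite (lin0 (dif_lin (dgcatP (skew rho)) _)) !(lin0 (@L _ _ _))
      (lin0 (dif_lin (dgcatP B) _)).
  + move=> u v hu hv; rewrite (linD _ _ (dif_lin (dgcatP (skew rho)) _)).
    by rewrite !(linD _ _ (@L _ _ _)) (linD _ _ (dif_lin (dgcatP B) _)) hu hv.
  + by move=> g a; rewrite [dif e _]skew_dif_hmor !skew_lift_hmor.
- by move=> X; rewrite [LHS]skew_lift_hmor.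
- move=> X Y Z m n p e g f; move: g f; apply: skew_ind.
  + by move=> f; rewrite cmp_lin0l !(lin0 (@L _ _ _)) cmp_lin0l.
  + move=> u v hu hv f; rewrite (linD _ _ (cmp_linl (dgcatP (skew rho)) _ _)).
    by rewrite !(linD _ _ (@L _ _ _)) (linD _ _ (cmp_linl (dgcatP B) _ _)) hu hv.
  move=> h b; apply: skew_ind.
  + by rewrite cmp_lin0r !(lin0 (@L _ _ _)) cmp_lin0r.
  + move=> u v hu hv; rewrite (linD _ _ (cmp_linr (dgcatP (skew rho)) _ _)).
    by rewrite !(linD _ _ (@L _ _ _)) (linD _ _ (cmp_linr (dgcatP B) _ _)) hu hv.
  by move=> g a; rewrite [cmp e _ _]skew_cmp_hmor !skew_lift_hmor -phi_cmp.
Qed.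

Definition skew_lift : dgfunctor (skew rho) B := Dgfunctor skew_lift_subproof.

End Lift.

Lemma skew_functor_ext (B : dgcat k) (F F' : dgfunctor (skew rho) B)
    (e : forall x, F x = F' x) :
  (forall X Y n g (a : mor (act rho g X) Y n),
     cast_tgt (e Y) (cast_src (e X) (fmor F (hmor a : mor (X : skew rho) (Y : skew rho) n))) =
     fmor F' (hmor a : mor (X : skew rho) (Y : skew rho) n)) -> F = F'.
Proof.
case: F F' e => [Fo Fm Fp] [Fo' Fm' Fp'] /= e.
have E : Fo = Fo' by apply: functional_extensionality_dep.
subst Fo' => H; apply: dgfunctor_eq.
do 3![apply: functional_extensionality_dep => ?].
apply: functional_extensionality_dep; apply: skew_ind.
- by rewrite (lin0 (@fmor_lin _ _ _ _ _ Fp _ _ _)) (lin0 (@fmor_lin _ _ _ _ _ Fp' _ _ _)).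
- move=> u v hu hv.
  rewrite (linD _ _ (@fmor_lin _ _ _ _ _ Fp _ _ _)) hu hv.
  by rewrite (linD _ _ (@fmor_lin _ _ _ _ _ Fp' _ _ _)).
- by move=> g a; rewrite -H cast_src_id cast_tgt_id.
Qed.

End SkewFunctors.

(** * Extension of invariant dg-functors from A to A*G *)

Section InvariantFunctors.
Variables (k : fieldType) (G : groupType) (rho : functor (BG G) (dgCat k)).

Definition invariant (B : dgcat k) (F : dgfunctor (base rho) B) : Prop :=
  forall g, dgcomp F (act rho g) = F.

Section Extension.
Variables (B : dgcat k) (F : dgfunctor (base rho) B) (Finv : invariant F).

Lemma invariant_ob g X : F (act rho g X) = F X.
Proof. exact: (f_equal (fun H : dgfunctor _ _ => H X) (Finv g)). Qed.

Lemma invariant_fmor g X Y n (a : mor X Y n) :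
  fmor F (fmor (act rho g) a) =
  cast_tgt (esym (invariant_ob g Y)) (cast_src (esym (invariant_ob g X)) (fmor F a)).
Proof. exact: (dgfunctor_fmor (esym (Finv g))). Qed.

(** Invariance identifies F(g.X) with F X, so F a can serve as the image of (g, a). In particular
    (g, id) goes to an identity, up to transport. *)
Let phi (X Y : base rho) n g (a : mor (act rho g X) Y n) : mor (F X) (F Y) n :=
  cast_src (invariant_ob g X) (fmor F a).

Let phi_lin X Y n g : linear (@phi X Y n g).
Proof. by move=> c u v; rewrite /phi (fmor_lin (dgfunctorP F)) cast_src_lin. Qed.

Let phi_dif X Y n p (e : n + 1 = p) g (a : mor (act rho g X) Y n) :
  phi (dif e a) = dif e (phi a).
Proof. by rewrite /phi (fmor_dif (dgfunctorP F)) dif_cast_src. Qed.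

Let phi_id X : phi (cast_src (act1 X) (idm X)) = idm (F X).
Proof.
by rewrite /phi fmor_cast_src cast_src_trans (fmor_id (dgfunctorP F)) cast_src_id.
Qed.

(** The twist in the composition of A*G disappears: F(h.a) is F a up to transport. *)
Let phi_cmp X Y Z m n p (e : m + n = p) h g
    (b : mor (act rho h Y) Z m) (a : mor (act rho g X) Y n) :
  phi (cmp e b (cast_src (actM h g X) (fmor (act rho h) a))) =
  cmp e (phi b) (phi a).
Proof.
rewrite /phi (fmor_cmp (dgfunctorP F)) fmor_cast_src invariant_fmor.
rewrite -cast_src_tgt !cmp_cast_src cmp_cast_mid !cast_src_trans.
by rewrite (cast_src_irr _ (invariant_ob g X)).
Qed.

Definition skew_ext : dgfunctor (skew rho) B := skew_lift phi_lin phi_dif phi_id phi_cmp.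

Lemma skew_ext_hmor X Y n g (a : mor (act rho g X) Y n) :
  fmor skew_ext (hmor a : mor (X : skew rho) (Y : skew rho) n) =
  cast_src (invariant_ob g X) (fmor F a).
Proof. exact: skew_lift_hmor. Qed.

Lemma skew_ext_incl : dgcomp skew_ext (skew_incl rho) = F.
Proof.
apply: (@dgfunctor_ext _ _ _ (dgcomp skew_ext (skew_incl rho)) F (fun=> erefl)) => X Y n f.
by rewrite cast_src_id cast_tgt_id [LHS]skew_ext_hmor fmor_cast_src cast_src_trans cast_src_id.
Qed.

End Extension.

Lemma skew_ext_eq (B : dgcat k) (F F' : dgfunctor (base rho) B)
    (Finv : invariant F) (Finv' : invariant F') :
  F = F' -> skew_ext Finv = skew_ext Finv'.
Proof. by move=> e; subst F'; rewrite (Prop_irrelevance Finv Finv'). Qed.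

Lemma invariant_comp (B C : dgcat k) (H : dgfunctor B C) (F : dgfunctor (base rho) B) :
  invariant F -> invariant (dgcomp H F).
Proof. by move=> Finv g; rewrite -[in RHS](Finv g); apply: dgfunctor_eq. Qed.

Lemma comp_skew_ext (B C : dgcat k) (H : dgfunctor B C) (F : dgfunctor (base rho) B)
    (Finv : invariant F) (HFinv : invariant (dgcomp H F)) :
  dgcomp H (skew_ext Finv) = skew_ext HFinv.
Proof.
apply: (@skew_functor_ext _ _ _ _ (dgcomp H (skew_ext Finv)) (skew_ext HFinv) (fun=> erefl))
  => X Y n g a.
rewrite cast_src_id cast_tgt_id dgcompE !skew_ext_hmor fmor_cast_src; apply: cast_src_irr.
Qed.

End InvariantFunctors.

(** * Functoriality of A*G in equivariant dg-functors *)

Section EquivariantFunctors.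
Variables (k : fieldType) (G : groupType) (rho rho' : functor (BG G) (dgCat k)).
Variable F : dgfunctor (base rho) (base rho').
Hypothesis Feq : forall g, dgcomp F (act rho g) = dgcomp (act rho' g) F.

Lemma equivariant_ob g X : F (act rho g X) = act rho' g (F X).
Proof. exact: (f_equal (fun H : dgfunctor _ _ => H X) (Feq g)). Qed.

Lemma equivariant_fmor g X Y n (a : mor X Y n) :
  fmor F (fmor (act rho g) a) =
  cast_tgt (esym (equivariant_ob g Y))
    (cast_src (esym (equivariant_ob g X)) (fmor (act rho' g) (fmor F a))).
Proof. exact: (dgfunctor_fmor (esym (Feq g))). Qed.

Let phi (X Y : base rho) n g (a : mor (act rho g X) Y n) :
    mor (F X : skew rho') (F Y : skew rho') n :=
  hmor (cast_src (equivariant_ob g X) (fmor F a)).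

Let phi_lin X Y n g : linear (@phi X Y n g).
Proof.
by move=> c u v; rewrite /phi (fmor_lin (dgfunctorP F)) cast_src_lin hmor_lin.
Qed.

Let phi_dif X Y n p (e : n + 1 = p) g (a : mor (act rho g X) Y n) :
  phi (dif e a) = dif e (phi a).
Proof.
by rewrite /phi (fmor_dif (dgfunctorP F)) [RHS]skew_dif_hmor dif_cast_src.
Qed.

Let phi_id X : phi (cast_src (act1 X) (idm X)) = idm (F X : skew rho').
Proof.
rewrite /phi fmor_cast_src cast_src_trans (fmor_id (dgfunctorP F)).
by congr hmor; apply: cast_src_irr.
Qed.

(** Equivariance turns F(h.a) into h.(F a), which is the twist in the composition of the target skew
    category. *)
Let phi_cmp X Y Z m n p (e : m + n = p) h g
    (b : mor (act rho h Y) Z m) (a : mor (act rho g X) Y n) :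
  phi (cmp e b (cast_src (actM h g X) (fmor (act rho h) a))) =
  cmp e (phi b) (phi a).
Proof.
rewrite [RHS]skew_cmp_hmor /hcmp /phi; congr hmor.
rewrite (fmor_cmp (dgfunctorP F)) !fmor_cast_src equivariant_fmor.
rewrite -cast_src_tgt !cmp_cast_src cmp_cast_mid !cast_src_trans.
exact: cast_src_irr.
Qed.

Definition skew_map : dgfunctor (skew rho) (skew rho') :=
  skew_lift phi_lin phi_dif phi_id phi_cmp.

Lemma skew_map_hmor X Y n g (a : mor (act rho g X) Y n) :
  fmor skew_map (hmor a : mor (X : skew rho) (Y : skew rho) n) =
  hmor (cast_src (equivariant_ob g X) (fmor F a)).
Proof. exact: skew_lift_hmor. Qed.

Lemma skew_ext_map (B : dgcat k) (H : dgfunctor (base rho') B)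
    (Hinv : invariant H) (HFinv : invariant (dgcomp H F)) :
  dgcomp (skew_ext Hinv) skew_map = skew_ext HFinv.
Proof.
apply: (@skew_functor_ext _ _ _ _ (dgcomp (skew_ext Hinv) skew_map)
  (skew_ext HFinv) (fun=> erefl))
  => X Y n g a.
rewrite cast_src_id cast_tgt_id dgcompE skew_map_hmor !skew_ext_hmor.
rewrite fmor_cast_src cast_src_trans; exact: cast_src_irr.
Qed.

End EquivariantFunctors.

(** * Cycles and homologies in A*G, component by component *)

Section SkewHomology.
Variables (k : fieldType) (G : groupType) (rho : functor (BG G) (dgCat k)).
Implicit Types X Y : skew rho.

(** Restates [dfun] with the summand family fixed, so that components are typed as morphisms of
    A. *)
Definition coef X Y n (f : mor X Y n) (g : G) : mor (act rho g X) Y n :=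
  @dfun k G (fun g => mor (act rho g X) Y n) f g.

Lemma coef_lin X Y n g : linear (fun f : mor X Y n => coef f g).
Proof. by []. Qed.

Lemma coef_hmor X Y n g (a : mor (act rho g X) Y n) :
  coef (hmor a : mor X Y n) g = a.
Proof. exact: (@injE k G (fun g => mor (act rho g X) Y n)). Qed.

Lemma coef_hmor_neq X Y n g h (a : mor (act rho g X) Y n) :
  g <> h -> coef (hmor a : mor X Y n) h = 0.
Proof. exact: (@injE_neq k G (fun g => mor (act rho g X) Y n)). Qed.

Lemma coef_inj X Y n (f f' : mor X Y n) : (forall g, coef f g = coef f' g) -> f = f'.
Proof. exact: (@dsum_eq k G (fun g => mor (act rho g X) Y n)). Qed.

Lemma coef_dif X Y n p (e : n + 1 = p) (f : mor X Y n) g :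
  coef (dif e f) g = dif e (coef f g).
Proof.
have D h := dif_lin (dgcatP (base rho)) (x := act rho h X) (y := Y) e.
have D' := dif_lin (dgcatP (skew rho)) (x := X) (y := Y) e.
move: f; apply: skew_ind.
- by rewrite (lin0 D') (lin0 (D g)).
- move=> u v hu hv; rewrite (linD _ _ D') !(linD _ _ (@coef_lin _ _ _ _)).
  by rewrite hu hv (linD _ _ (D g)).
move=> h a; rewrite [dif e _]skew_dif_hmor.
have [e'|ne] := pselect (h = g); first by subst h; rewrite !coef_hmor.
by rewrite !coef_hmor_neq// (lin0 (D g)).
Qed.

Lemma coef_cycle X Y n (f : mor X Y n) :
  is_cycle f <-> forall g, is_cycle (coef f g).
Proof.
split=> [cf g|cf]; first by rewrite /is_cycle -coef_dif cf.
by apply: coef_inj => g; rewrite coef_dif cf.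
Qed.

Lemma coefB X Y n (f f' : mor X Y n) g : coef (f - f') g = coef f g - coef f' g.
Proof. by []. Qed.

Lemma coef_homologous X Y n (f f' : mor X Y n) :
  homologous f f' <-> forall g, homologous (coef f g) (coef f' g).
Proof.
split=> [[h hE] g|ff'].
  by exists (coef h g); rewrite -coef_dif hE.
have [h hE] : {h : forall g, mor (act rho g X) Y (n - 1) |
    forall g, dif (subrK 1 n) (h g) = coef f g - coef f' g}.
  exists (fun g => projT1 (cid (ff' g))) => g.
  exact: projT2 (cid (ff' g)).
(* The chosen [h g] may be nonzero for infinitely many [g]; resetting it to 0 where the difference
   vanishes makes the support finite. *)
pose h' g := if coef f g - coef f' g == 0 then 0 else h g.
have h'P : fin_supp h'.
  apply: sub_finite_set (dfunP (f - f')) => g /=.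
  by rewrite /h' -coefB; apply: contra_neq => ->; rewrite eqxx.
exists (Dsum h'P : mor X Y (n - 1)); apply: coef_inj => g.
rewrite coefB coef_dif -[coef (Dsum h'P) g]/(h' g) /h'; case: eqP => [->|_]; last exact: hE.
exact: lin0 (dif_lin (dgcatP (base rho)) _).
Qed.

End SkewHomology.

(** * The skew construction preserves quasi-equivalences *)

Section SkewMapQuasiEquivalence.
Variables (k : fieldType) (G : groupType) (rho rho' : functor (BG G) (dgCat k)).
Variable F : dgfunctor (base rho) (base rho').
Hypothesis Feq : forall g, dgcomp F (act rho g) = dgcomp (act rho' g) F.

Lemma coef_skew_map (X Y : skew rho) n (f : mor X Y n) g :
  coef (fmor (skew_map Feq) f) g = cast_src (equivariant_ob Feq g X) (fmor F (coef f g)).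
Proof.
have L := @fmor_lin _ _ _ _ _ (dgfunctorP (skew_map Feq)) X Y n.
have L' := @fmor_lin _ _ _ _ _ (dgfunctorP F) (act rho g X) Y n.
have C := @cast_src_lin _ _ _ _ (F Y) n (equivariant_ob Feq g X).
move: f; apply: skew_ind.
- by rewrite (lin0 L) (lin0 L') (lin0 C).
- move=> u v hu hv; rewrite (linD _ _ L) !(linD _ _ (@coef_lin _ _ _ _ _ _ _)).
  by rewrite hu hv (linD _ _ L') (linD _ _ C).
move=> h a; rewrite skew_map_hmor.
have [e|ne] := pselect (h = g); first by subst h; rewrite !coef_hmor.
by rewrite !coef_hmor_neq// (lin0 L') (lin0 C).
Qed.

Lemma cast_src_cycle (A : dgcat k) (x x' y : A) n (e : x = x') (f : mor x y n) :
  is_cycle (cast_src e f) <-> is_cycle f.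
Proof. by subst x'. Qed.

Lemma cast_src_homologous (A : dgcat k) (x x' y : A) n (e : x = x') (f g : mor x y n) :
  homologous (cast_src e f) (cast_src e g) <-> homologous f g.
Proof. by subst x'. Qed.

Lemma homologous_refl (A : dgcat k) (x y : A) n (f : mor x y n) : homologous f f.
Proof. by exists 0; rewrite subrr (lin0 (dif_lin (dgcatP A) _)). Qed.

Lemma skew_map_quasi_equivalence :
  quasi_equivalence F -> quasi_equivalence (skew_map Feq).
Proof.
move=> [F1 F2 F3]; split.
- move=> X Y n f f' /coef_cycle cf /coef_cycle cf' /coef_homologous ff'.
  apply/coef_homologous => g; apply: F1 => //.
  by have := ff' g; rewrite !coef_skew_map cast_src_homologous.
- move=> X Y n f /coef_cycle cf.
  (* The last clause forces a zero preimage wherever the component of [f] vanishes, so that the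
     chosen family has finite support. *)
  have H g : exists a : mor (act rho g X) Y n, [/\ is_cycle a,
      homologous (cast_src (equivariant_ob Feq g X) (fmor F a)) (coef f g)
      & coef f g = 0 -> a = 0].
    have [f0|f0] := eqVneq (coef f g) 0.
      exists 0; split=> //; first exact: lin0 (dif_lin (dgcatP _) _).
      by rewrite f0 fmor0 (lin0 (@cast_src_lin _ _ _ _ _ _ _)); apply: homologous_refl.
    have /F2[a ca fa] : is_cycle (cast_src (esym (equivariant_ob Feq g X)) (coef f g)).
      exact/cast_src_cycle.
    exists a; split => //; last by move=> f0'; rewrite f0' eqxx in f0.
    (* Inserting a transport back and forth puts both sides under one common cast. *)
    rewrite -[coef f g](@cast_src_id _ _ _ _ _
      (etrans (esym (equivariant_ob Feq g X)) (equivariant_ob Feq g X))).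
    by rewrite -cast_src_trans; apply/cast_src_homologous.
  pose a g := projT1 (cid (H g)).
  have aP g := projT2 (cid (H g)) : [/\ is_cycle (a g), _ & _].
  have a_fin : fin_supp a.
    apply: sub_finite_set (dfunP f) => g /=; apply: contra_neq => f0.
    by have [_ _] := aP g; apply.
  exists (Dsum a_fin : mor X Y n).
    by apply/coef_cycle => g; have [] := aP g.
  by apply/coef_homologous => g; rewrite coef_skew_map; have [] := aP g.
(* [skew_incl] is the identity on objects and preserves isomorphisms of H^0, so essential
   surjectivity is inherited from [F]. *)
- move=> Y; have [X [u u_iso]] := F3 Y; exists X, (fmor (skew_incl rho') u).
  exact: (fmor_H0_iso (skew_incl rho') u_iso).
Qed.

End SkewMapQuasiEquivalence.

(** * Orbit representatives and invariance of [to_red] for free actions *)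

Section FreeActions.
Variables (k : fieldType) (G : groupType) (rho : functor (BG G) (dgCat k)).

Lemma orbit_refl (X : base rho) : exists Y, exists g, act rho g Y = X.
Proof. by exists X, 1%g; rewrite -act1. Qed.

(** With the orbits of X and g.X equal as predicates, [cid] picks the same element from both; this
    yields the field [rep_act] of [some_orbit_reps]. *)
Lemma orbit_act g (X : base rho) :
  (fun Y => exists h, act rho h Y = act rho g X) = (fun Y => exists h, act rho h Y = X).
Proof.
apply: functional_extensionality_dep => Y; apply: propext.
split=> [[h hE]|[h <-]]; last by exists (g * h)%g; rewrite actM.
by exists (g^-1 * h)%g; rewrite -actM hE actM mulVg -act1.
Qed.

Lemma cid_irr (T : Type) (P P' : T -> Prop) (p : exists x, P x) (p' : exists x, P' x) :
  P = P' -> projT1 (cid p) = projT1 (cid p').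
Proof. by move=> e; subst P'; rewrite (Prop_irrelevance p p'). Qed.

Definition some_orbit_reps : orbit_reps rho :=
  @OrbitReps k G rho (fun X => projT1 (cid (orbit_refl X)))
    (fun X => projT2 (cid (orbit_refl X))) (fun g X => cid_irr _ _ (orbit_act g X)).

Hypothesis rho_free : free_on_objects rho.
Variable R : orbit_reps rho.

Lemma free_act_inj g h (X : base rho) : act rho g X = act rho h X -> g = h.
Proof.
move=> gh; apply/(mulgI h^-1%g); rewrite mulVg; apply: (rho_free (X := X)).
by rewrite -actM gh actM mulVg -act1.
Qed.

Lemma skew_cast_src_hmor (X X' Y : base rho) n (e : X = X') g (a : mor (act rho g X) Y n) :
  @cast_src k (skew rho) X X' Y n e (hmor a) =
  hmor (cast_src (f_equal (act rho g) e) a).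
Proof. by subst X'. Qed.

Lemma skew_cast_tgt_hmor (X Y Y' : base rho) n (e : Y = Y') g (a : mor (act rho g X) Y n) :
  @cast_tgt k (skew rho) X Y Y' n e (hmor a) = hmor (cast_tgt e a).
Proof. by subst Y'. Qed.

(** The product is a variable with an equation, so that group identities can be applied without
    rewriting inside dependent types. *)
Lemma fmor_actM g h gh (X Y : base rho) n (a : mor X Y n) : (g * h)%g = gh ->
  forall eX eY,
    fmor (act rho g) (fmor (act rho h) a) = cast_tgt eY (cast_src eX (fmor (act rho gh) a)).
Proof. by move=> <- eX eY; apply: (dgfunctor_fmor (actMF rho g h)). Qed.

Lemma conj_rep_source (X Y : base rho) g :
  act rho (to_rep R Y)^-1%g (act rho g X) =
  act rho ((to_rep R Y)^-1 * (g * to_rep R X))%g (rep R X).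
Proof. by rewrite -!actM to_repE. Qed.

(** Writing t for [to_rep R], the conjugate of (g, a) is (t_Y^-1 g t_X, t_Y^-1.a): the identities
    inside [rep_iso] and [rep_iso_inv] contribute only casts. *)
Lemma conj_rep_hmor (X Y : base rho) n g (a : mor (act rho g X) Y n) :
  conj_rep R (hmor a : mor (X : skew rho) (Y : skew rho) n) =
  @hmor k G rho (rep R X) (rep R Y) n _
    (cast_tgt (esym (to_repVE R Y)) 
      (cast_src (conj_rep_source X Y g) (fmor (act rho (to_rep R Y)^-1%g) a))).
Proof.
rewrite /conj_rep [cmp (addr0 n) _ _]skew_cmp_hmor [LHS]skew_cmp_hmor /hcmp.
congr hmor.
rewrite fmor_cast_src (fmor_id (dgfunctorP (act rho _))) !cmp_cast_src.
rewrite (cmpm1 (dgcatP (base rho))) !fmor_cast_src !cast_src_trans cmp_cast_src.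
rewrite cmp_cast_mid (cmp1m (dgcatP (base rho))) -cast_src_tgt cast_src_trans.
exact: cast_src_irr.
Qed.

Lemma to_red_ob_act g X : to_red R (act rho g X) = to_red R X.
Proof. exact/eq_exist/rep_act. Qed.

(** Both elements carry the representative of X to g.X, so they agree by freeness. *)
Lemma to_rep_act g X : to_rep R (act rho g X) = (g * to_rep R X)%g.
Proof.
apply: (@free_act_inj _ _ (rep R X)).
by rewrite -[in LHS](rep_act R g) to_repE -actM to_repE.
Qed.

(** By [to_rep_act] the factors g cancel, both in the group component t_(gY)^-1 t_(gX) = t_Y^-1 t_X
    and in t_(gY)^-1.(g.f) = t_Y^-1.f. *)
Lemma to_red_invariant : invariant (to_red R).
Proof.
move=> g; apply: (@dgfunctor_ext _ _ _ (dgcomp (to_red R) (act rho g)) (to_red R)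
  (to_red_ob_act g)).
move=> X Y n f; rewrite full_cast_tgt full_cast_src.
rewrite [fmor (dgcomp _ _) f]conj_rep_hmor [RHS]conj_rep_hmor.
rewrite skew_cast_src_hmor skew_cast_tgt_hmor.
apply: hmor_cast => [|e].
  by rewrite !to_rep_act invgM !mul1g mulgA -(mulgA _ g^-1%g) mulVg mulg1.
rewrite !fmor_cast_src.
have eg : ((to_rep R (act rho g Y))^-1 * g)%g = (to_rep R Y)^-1%g.
  by rewrite to_rep_act invgM -mulgA mulVg mulg1.
have eX Z : act rho (to_rep R (act rho g Y))^-1%g (act rho g Z) =
            act rho (to_rep R Y)^-1%g Z by rewrite actM eg.
rewrite (fmor_actM f eg (esym (eX X)) (esym (eX Y))).
rewrite !(cast_src_tgt, cast_src_trans, cast_tgt_trans).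
by rewrite (cast_tgt_irr _ (esym (to_repVE R Y))); congr cast_tgt; apply: cast_src_irr.
Qed.

(** The extension treats (g, a) as (e, a) with source g.X; its group component t_Y^-1 t_(gX) equals
    t_Y^-1 g t_X, as conjugation requires. *)
Lemma skew_to_redE : skew_to_red R = skew_ext to_red_invariant.
Proof.
apply: (@skew_functor_ext _ _ _ _ (skew_to_red R) (skew_ext to_red_invariant) (fun=> erefl)).
move=> X Y n g a; rewrite cast_src_id cast_tgt_id skew_ext_hmor full_cast_src.
rewrite [LHS]conj_rep_hmor [fmor (to_red R) a]conj_rep_hmor skew_cast_src_hmor.
apply: hmor_cast => [|e]; first by rewrite to_rep_act mul1g.
rewrite fmor_cast_src !(cast_src_tgt, cast_src_trans, cast_tgt_trans).
by congr cast_tgt; apply: cast_src_irr.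
Qed.

End FreeActions.

(** * The equivalence between A*G and its reduced form *)

Lemma conj_cancel (k : fieldType) (A : dgcat k) (x x' y y' : A) n
    (u : mor x x' 0) (u' : mor x' x 0) (v : mor y y' 0) (v' : mor y' y 0)
    (f : mor x y n) :
  cmp (addr0 0) u' u = idm x -> cmp (addr0 0) v' v = idm y ->
  cmp (add0r n) v' (cmp (addr0 n) (cmp (add0r n) v (cmp (addr0 n) f u')) u) = f.
Proof.
move=> uu vv; have S := cmpA (dgcatP A).
rewrite -(S _ _ _ _ _ _ _ _ _ _ (add0r n) (addr0 n) (addr0 n) (add0r n)).
rewrite -(S _ _ _ _ _ _ _ _ _ _ (addr0 n) (addr0 n) (addr0 0) (addr0 n)).
rewrite uu (cmpm1 (dgcatP A)).
rewrite (S _ _ _ _ _ _ _ _ _ _ (addr0 0) (add0r n) (add0r n) (add0r n)).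
by rewrite vv (cmp1m (dgcatP A)).
Qed.

Lemma skew_to_red_surjective_equivalence (k : fieldType) (G : groupType)
    (rho : functor (BG G) (dgCat k)) (R : orbit_reps rho) :
  surjective_equivalence (skew_to_red R).
Proof.
split.
- move=> X Y n f f' ff'; have {}ff' : conj_rep R f = conj_rep R f' := ff'.
  have H (h : mor X Y n) : cmp (add0r n) (rep_iso R Y)
      (cmp (addr0 n) (conj_rep R h) (rep_iso_inv R X)) = h.
    exact: conj_cancel (rep_isoK R X) (rep_isoK R Y).
  by rewrite -(H f) ff' H.
- move=> X Y n f; pose f' : @mor k (skew rho) (rep R X) (rep R Y) n := f.
  exists (cmp (add0r n) (rep_iso R Y) (cmp (addr0 n) f' (rep_iso_inv R X))).
  exact: conj_cancel (rep_isoVK R X) (rep_isoVK R Y).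
- by move=> [Y YR]; exists Y; apply: eq_exist.
Qed.

(** The extension sends [rep_iso] and its inverse to transported identities, so conjugating by them
    first changes nothing. Hence it factors through the reduced category. *)
Lemma skew_ext_to_red (k : fieldType) (G : groupType) (rho : functor (BG G) (dgCat k))
    (R : orbit_reps rho) (B : dgcat k) (F : dgfunctor (base rho) B) (Finv : invariant F) :
  dgcomp (dgcomp (skew_ext Finv) (full_incl (fun X : skew rho => rep R X = X)))
    (skew_to_red R) = skew_ext Finv.
Proof.
have e X : F (rep R X) = F X by rewrite -{2}(to_repE R X) (invariant_ob Finv).
have E1 X : fmor (skew_ext Finv) (rep_iso R X) = cast_src (esym (e X)) (idm (F X)).
  rewrite skew_ext_hmor fmor_cast_src cast_src_trans (fmor_id (dgfunctorP F)).
  exact: cast_src_irr.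
have E2 X : fmor (skew_ext Finv) (rep_iso_inv R X) = cast_src (e X) (idm (F (rep R X))).
  rewrite skew_ext_hmor fmor_cast_src cast_src_trans (fmor_id (dgfunctorP F)).
  exact: cast_src_irr.
apply: (@dgfunctor_ext _ _ _ (dgcomp (dgcomp (skew_ext Finv) (full_incl _)) (skew_to_red R))
  (skew_ext Finv) e) => X Y n f.
rewrite -[fmor (dgcomp _ _) f]/(fmor (skew_ext Finv) (conj_rep R f)).
rewrite /conj_rep !(fmor_cmp (dgfunctorP (skew_ext Finv))) E1 E2.
rewrite !cmp_cast_src (cmpm1 (dgcatP B)) cmp_cast_mid (cmp1m (dgcatP B)).
by rewrite !(cast_src_tgt, cast_src_trans, cast_tgt_trans) cast_tgt_id cast_src_id.
Qed.

(** * Projectively cofibrant diagrams are free on objects *)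

Section ZeroDgCategories.
Variable k : fieldType.

Lemma rV0_eq (u v : 'rV[k]_0) : u = v.
Proof. by rewrite [u]thinmx0 [v]thinmx0. Qed.

Lemma zero_dgcat_subproof (T : Type) : @is_dgcat k T (fun _ _ _ => 'rV[k]_0)
  (fun _ _ _ _ _ _ => 0) (fun=> 0) (fun _ _ _ _ _ _ _ _ _ => 0).
Proof. by split; repeat move=> ?; apply: rV0_eq. Qed.

(** The codiscrete dg-category on [T]: a dg-functor into it is just a map of objects, and all its
    objects are isomorphic. *)
Definition zero_dgcat (T : Type) : dgcat k := Dgcat (zero_dgcat_subproof T).

Lemma zero_mor_eq (T : Type) (x y : zero_dgcat T) n (f g : mor x y n) : f = g.
Proof. exact: rV0_eq. Qed.

Lemma zero_dgfunctor_subproof (A : dgcat k) (T : Type) (F : A -> T) :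
  @is_dgfunctor k A (zero_dgcat T) F (fun _ _ _ _ => 0).
Proof. by split; repeat move=> ?; apply: zero_mor_eq. Qed.

Definition zero_dgfunctor (A : dgcat k) (T : Type) (F : A -> T) :
  dgfunctor A (zero_dgcat T) := Dgfunctor (zero_dgfunctor_subproof F).

Lemma zero_dgfunctor_eq (A : dgcat k) (T : Type) (F F' : dgfunctor A (zero_dgcat T)) :
  (forall x, F x = F' x) -> F = F'.
Proof. by move=> e; apply: (dgfunctor_ext (e := e)) => *; apply: zero_mor_eq. Qed.

Lemma zero_homologous (T : Type) (x y : zero_dgcat T) n (f g : mor x y n) :
  homologous f g.
Proof. by exists 0; apply: zero_mor_eq. Qed.

Lemma zero_H0_iso (T : Type) (x y : zero_dgcat T) (u : mor x y 0) : H0_iso u.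
Proof.
split; first exact: zero_mor_eq.
by exists 0; split; [apply: zero_mor_eq | apply: zero_homologous ..].
Qed.

Lemma zero_quasi_equivalence (T T' : Type) (F : dgfunctor (zero_dgcat T) (zero_dgcat T')) :
  inhabited T -> quasi_equivalence F.
Proof.
move=> [t]; split.
- by move=> *; apply: zero_homologous.
- by move=> x y n g _; exists 0; [apply: zero_mor_eq | apply: zero_homologous].
- by move=> b; exists t, 0; apply: zero_H0_iso.
Qed.

Lemma zero_dg_fibration (T : Type) (F : dgfunctor (zero_dgcat T) (zero_dgcat unit)) :
  dg_fibration F.
Proof.
split; first by move=> x y n g; exists 0; apply: zero_mor_eq.
move=> x b v _; have e : F x = b by case: (F x) b {v} => [] [].
by exists x, e, 0; split; [apply: zero_H0_iso | apply: zero_homologous].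
Qed.

Variable G : groupType.

(** The analogue of EG: a free G-object whose map to the point is a trivial fibration. *)
Definition translation_diagram : functor (BG G) (dgCat k).
Proof.
refine (@Functor (BG G) (dgCat k) (fun=> zero_dgcat G)
  (fun _ _ g => zero_dgfunctor (fun h : zero_dgcat G => (g * h)%g)) _ _).
- by move=> i; apply: zero_dgfunctor_eq => h; apply: mul1g.
- by move=> i j l g h; apply: zero_dgfunctor_eq => x; rewrite /= mulgA.
Defined.

Definition point_diagram : functor (BG G) (dgCat k).
Proof.
refine (@Functor (BG G) (dgCat k) (fun=> zero_dgcat unit)
  (fun _ _ _ => dgid (zero_dgcat unit)) _ _).
- by [].
- by move=> *; apply: zero_dgfunctor_eq.
Defined.

Definition to_point (D : functor (BG G) (dgCat k)) : nattrans D point_diagram.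
Proof.
refine (@Nattrans (BG G) (dgCat k) D point_diagram
  (fun i => zero_dgfunctor (fun _ : fobj D i => tt)) _).
by move=> *; apply: zero_dgfunctor_eq.
Defined.

(* Lifting [Q -> point] along the trivial fibration [translation -> point]
   gives an equivariant map from the objects of [Q] to [G]. *)
Lemma projective_cofibrant_free (Q : functor (BG G) (dgCat k)) :
  cofibrant (projective_model (qe_model k) (BG G)) Q -> free_on_objects Q.
Proof.
move=> [o [i [o_init i_cof]]] g X gX.
have [u [_ _]] := o_init translation_diagram.
have lift : has_lifts i (to_point translation_diagram : hom (_ : functor_cat _ _) _).
  apply: i_cof => j; last exact: zero_dg_fibration.
  by apply: zero_quasi_equivalence; exists; exact: 1%g.
have [|l _] := lift u (to_point Q).
  (* The lifting square commutes because both composites start at the initial diagram. *)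
  have [w [_ wU]] := o_init point_diagram.
  by rewrite -(wU (_ \oc u)) // -(wU (_ \oc i)).
have := f_equal (fun F : dgfunctor _ _ => F X) (@ncompE _ _ _ _ l tt tt g).
(* Naturality of the lift reads l(g.X) = g l(X); as g.X = X, cancelling l(X) in G leaves g = 1. *)
rewrite /= -/(act Q g) gX => lX.
by apply/esym; apply: (mulIg (l tt X)); rewrite mul1g.
Qed.

End ZeroDgCategories.

(** * The comparison map out of the colimit *)

Theorem proposition3p10 (k : fieldType) (G : groupType)
    (rho : functor (BG G) (dgCat k))
    (hcof : cofibrant (qe_model k) (base rho))
    (hfree : free_on_objects rho)
    (R : orbit_reps rho) :
  @is_hocolim_cocone (dgCat k) (qe_model k) (BG G) rho (skew_red R) (red_cocone R).
Proof.
split; first by move=> [] [] g; apply: to_red_invariant.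
move=> Q q Qcof q_weq s b [b_cocone b_univ] m mE.
have Qfree : free_on_objects Q := projective_cofibrant_free Qcof.
pose RQ := some_orbit_reps Q.
pose F : dgfunctor (base Q) (base rho) := q tt.
have Feq g : dgcomp F (act Q g) = dgcomp (act rho g) F by apply: (ncompE q).
pose c : dgfunctor (base Q) s := b tt.
have c_inv : invariant c by move=> g; apply: (b_cocone tt tt g).
have cRQ_inv : invariant (to_red RQ) := to_red_invariant Qfree RQ.
have [phi [phiE _]] := b_univ _ (red_cocone RQ) (fun i j g =>
  match i, j with tt, tt => cRQ_inv g end).
have phi_c : dgcomp phi c = to_red RQ := phiE tt.
(* The candidate inverse of [phi]: extend the colimit cocone to Q*G, then restrict to
   representatives. *)
pose psi := dgcomp (skew_ext c_inv) (full_incl (fun X : skew Q => rep RQ X = X)).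
have psi_c : dgcomp psi (to_red RQ) = c.
  rewrite -[RHS](skew_ext_incl c_inv) -(skew_ext_to_red RQ c_inv).
  exact: dgfunctor_eq.
(* Both sides are compatible with the colimit cocone. This one-sided inverse suffices for
   [surjective_equivalence_section]. *)
have psi_phi : dgcomp psi phi = dgid s.
  have [w [_ wU]] := b_univ s b b_cocone.
  rewrite -(wU (dgcomp psi phi)).
    by apply: wU => i; apply: (@comp1c (dgCat k)).
  by move=> []; rewrite -[RHS]psi_c -phi_c; apply: dgfunctor_eq.
(* Both sides are the extension of the invariant dg-functor [to_red RQ]. *)
have phi_ext : dgcomp phi (skew_ext c_inv) = skew_to_red RQ.
  have pc_inv : invariant (dgcomp phi c) by apply: invariant_comp.
  rewrite (comp_skew_ext _ pc_inv) (skew_to_redE Qfree); exact: skew_ext_eq.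
have ext_equiv : surjective_equivalence (skew_ext c_inv).
  apply: (surjective_equivalence_section psi_phi).
  by rewrite phi_ext; apply: skew_to_red_surjective_equivalence.
(* It remains to treat the composite Q*G -> s -> (A*G)^red. It extends [dgcomp (to_red R) F], hence
   equals [skew_map Feq] followed by [skew_to_red R]. *)
apply: (quasi_equivalence_cancel ext_equiv).
have mc : dgcomp m c = dgcomp (to_red R) F := mE tt.
have toF_inv : invariant (dgcomp (to_red R) F) by rewrite -mc; apply: invariant_comp.
have mc_inv : invariant (dgcomp m c) by apply: invariant_comp.
rewrite (comp_skew_ext _ mc_inv) (skew_ext_eq mc_inv toF_inv mc).
rewrite -(skew_ext_map Feq (to_red_invariant hfree R)) -skew_to_redE.
apply: quasi_equivalence_comp; last exact: skew_to_red_surjective_equivalence.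
exact: skew_map_quasi_equivalence (q_weq tt).
Qed.
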